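(* Let $t>1$ be an integer, and for each positive integer $n$ let $\delta_t^e(n) := p_t^e(n)/p(n)$ and $\delta_t^o(n) := p_t^o(n)/p(n)$. 1) If $t$ is even, then $$\lim_{n\to\infty}\delta_t^e(n)=\lim_{n\to\infty}\delta_t^o(n)=\frac12.$$ 2) If $t$ is odd, then, as $n\to\infty$ through integers of a fixed parity, $$\lim_{n\to\infty}\delta_t^e(n)=\begin{cases}\dfrac12+\dfrac{1}{2^{(t+1)/2}} & \text{if } 2\mid n,\\[2mm] \dfrac12-\dfrac{1}{2^{(t+1)/2}} & \text{if } 2\nmid n,\end{cases}\qquad \lim_{n\to\infty}\delta_t^o(n)=\begin{cases}\dfrac12-\dfrac{1}{2^{(t+1)/2}} & \text{if } 2\mid n,\\[2mm] \dfrac12+\dfrac{1}{2^{(t+1)/2}} & \text{if } 2\nmid n.\end{cases}$$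
   Context: A partition $\lambda$ of $n$ is a weakly decreasing sequence of positive integers $\lambda_1\ge\cdots\ge\lambda_k$ summing to $n$; $p(n)$ is the number of partitions of $n$. In the Ferrers–Young diagram of $\lambda$ (row $i$ has $\lambda_i$ left-aligned cells), the hook number $H_\lambda(i,j)$ of cell $(i,j)$ is the number of cells $(a,b)$ of the diagram with $a=i, b\ge j$ or $b=j, a\ge i$ (i.e. the usual hook length: the cell itself plus the cells to its right in its row and below it in its column). For an integer $t\ge 2$, $\mathcal{H}_t(\lambda)$ is the multiset of hook numbers of $\lambda$ that are multiples of $t$. Define $p_t^e(n)$ (resp. $p_t^o(n)$) as the number of partitions $\lambda$ of $n$ with $\#\mathcal{H}_t(\lambda)$ even (resp. odd). *)

(* Defs.v *)
From HB Require Import structures.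
From mathcomp Require Import all_boot all_order all_algebra reals.

Set Implicit Arguments.
Unset Strict Implicit.
Unset Printing Implicit Defensive.

Definition is_partition (n : nat) (s : seq nat) : bool :=
  [&& sorted geq s, all (fun k => 0 < k)%N s & sumn s == n].

Record partition_of (n : nat) := PartitionOf {
  parts :> seq nat;
  partsP : is_partition n parts
}.

HB.instance Definition _ n := [isSub for @parts n].
HB.instance Definition _ n := [Countable of partition_of n by <:].

(* The parts of a partition of n are at most n in number and at most n in     *)
(* size, so partition_of n embeds into the finite type {bseq n of 'I_n.+1}.   *)

Lemma partition_size n (la : partition_of n) : (size la <= n)%N.
Proof.
case: la => s /= /and3P[_ + /eqP<-].
elim: s => //= x s IHs /andP[x_gt0 /IHs le_s].
by rewrite -add1n leq_add.
Qed.

Lemma partition_part_le n (la : partition_of n) k : k \in parts la -> (k <= n)%N.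
Proof.
case: la => s /= /and3P[_ _ /eqP<-].
by move=> k_s; rewrite (perm_sumn (perm_to_rem k_s)) leq_addr.
Qed.

Lemma partition_encode_subproof n (la : partition_of n) :
  (size [seq (inord k : 'I_n.+1) | k <- parts la] <= n)%N.
Proof. by rewrite size_map partition_size. Qed.

Definition partition_encode n (la : partition_of n) : {bseq n of 'I_n.+1} :=
  Bseq (partition_encode_subproof la).

Definition partition_decode n (b : {bseq n of 'I_n.+1}) :
  option (partition_of n) := insub [seq nat_of_ord k | k <- b].

Lemma partition_encodeK n : pcancel (@partition_encode n) (@partition_decode n).
Proof.
move=> la; rewrite /partition_decode /= -map_comp (_ : map _ _ = parts la).
  exact: valK.
rewrite -[RHS]map_id; apply/eq_in_map => k /partition_part_le k_le /=.
by rewrite inordK.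
Qed.

HB.instance Definition _ n :=
  isFinite.Build (partition_of n) (pcan_enumP (@partition_encodeK n)).

(* Rows and columns are numbered from 0, so (i, j) is a cell when             *)
(* j < nth 0 la i.                                                            *)
Definition cells (la : seq nat) : seq (nat * nat) :=
  [seq (i, j) | i <- iota 0 (size la), j <- iota 0 (nth 0%N la i)].

Definition hook_number (la : seq nat) (c : nat * nat) : nat :=
  count (fun d : nat * nat =>
           ((d.1 == c.1) && (c.2 <= d.2)%N) || ((d.2 == c.2) && (c.1 <= d.1)%N))
        (cells la).

(* The multiset of hook numbers divisible by t, as a list with multiplicity.  *)
Definition t_hooks (t : nat) (la : seq nat) : seq nat :=
  [seq h <- [seq hook_number la c | c <- cells la] | (t %| h)%N].

Definition npart (n : nat) : nat := #|{: partition_of n}|.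

Definition npart_even (t n : nat) : nat :=
  #|[pred la : partition_of n | ~~ odd (size (t_hooks t la))]|.

Definition npart_odd (t n : nat) : nat :=
  #|[pred la : partition_of n | odd (size (t_hooks t la))]|.

Definition delta_even (R : realType) (t n : nat) : R :=
  ((npart_even t n)%:R / (npart n)%:R)%R.

Definition delta_odd (R : realType) (t n : nat) : R :=
  ((npart_odd t n)%:R / (npart n)%:R)%R.

(* Main.v *)
(* The t-core and t-quotient of la turn the number of hooks divisible by t    *)
(* into the total size w of the quotient, so that both p(n) and the signed    *)
(* count p^e(n) - p^o(n) become sums, over the core lattice of vectors        *)
(* c in Z^t with sum 0, of the number pt(w) of t-tuples of partitions of      *)
(* w = (n - |core c|) / t, weighted by 1 and by (-1)^w respectively.          *)
(*   Along a line c + Z t(e_i - e_j) the size |core c| is a convex quadratic, *)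
(* hence the weights pt(w) are unimodal: a function that alternates in sign   *)
(* along such lines has sum at most the sum of the weights at the peaks of    *)
(* the lines. Since pt(w + 1) / pt(w) -> 1, many neighbours of a peak have    *)
(* comparable weight, so the peaks are a vanishing proportion of p(n).        *)
(*   For t even (-1)^w alternates along t(e_1 - e_0). For t = 2k + 1 the sign *)
(* is (-1)^n (-1)^|core c|, which alternates along t(e_2l - e_2l+1) unless    *)
(* c_2l = c_2l+1 modulo 2, equals (-1)^n if all k pairs agree modulo 2, and   *)
(* the steps t(e_2l - e_2k) show that this has asymptotic probability 2^-k.   *)

Require Import Defs.
From HB Require Import structures.
From mathcomp Require Import all_boot all_order all_algebra.
From mathcomp Require Import all_classical all_reals all_analysis.
From mathcomp Require Import zify ring lra.

Import Order.TTheory GRing.Theory Num.Theory.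
Import numFieldNormedType.Exports.

Set Implicit Arguments.
Unset Strict Implicit.
Unset Printing Implicit Defensive.

(** * Growth of the partition function *)

(** Place the beads of a beta-set on t runners. A hook divisible by t is a bead above a gap on the
    same runner, so [tinv_split] identifies the number of such hooks with the total size w of the
    t-quotient. [sum_t_hooks_cores] then turns every sum over partitions of n into a sum over core
    vectors c, weighted by [pt t w] where n = |c| + t w.

    The bias (p_t^e(n) - p_t^o(n)) / p(n) thus becomes an average of (-1)^w over cores. Averages of
    bounded functions that change sign along t(e_i - e_j) tend to 0 ([alternating_small]): they are
    bounded by the total weight at the peaks of the lines ([alternating_le_peak]), and apart from
    small quotients each peak starts a run of J points of at least half its weight
    ([csum_peak_small]). The analytic input is that p(n) outgrows polynomials and that consecutive
    values of p, hence of [pt t], have ratio tending to 1 ([npart_slow], [pt_slow]).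

    For even t the bias tends to 0. For t = 2k+1 one has (-1)^n (-1)^w = (-1)^|c|. Cores with a pair
    of runners of unequal parity cancel ([negligible_sign_matched]), the sign is +1 when all k pairs
    agree ([core_size_parity]), and this has asymptotic frequency 2^-k ([negligible_matched]). *)

Lemma geq_total : total geq. Proof. by move=> m n; apply: leq_total. Qed.
Lemma geq_trans : transitive geq.
Proof. by move=> m n p mn np; apply: leq_trans np mn. Qed.
Lemma geq_anti : antisymmetric geq.
Proof. by move=> m n; rewrite /geq /= andbC => /anti_leq. Qed.

Lemma partition_perm_eq n (la mu : partition_of n) : perm_eq la mu -> la = mu.
Proof.
move=> eq_lm; apply: val_inj; apply: (sorted_eq geq_trans geq_anti) eq_lm.
  by case: la => s /= /and3P[].
by case: mu => s /= /and3P[].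
Qed.

Lemma partition_sumn n (la : partition_of n) : sumn la = n.
Proof. by case: la => s /= /and3P[_ _ /eqP]. Qed.

Lemma partition_gt0 n (la : partition_of n) k : k \in parts la -> 0 < k.
Proof. by case: la => s /= /and3P[_ /allP + _] => /[apply]. Qed.

Lemma sort_is_partition n s :
  all (fun k => 0 < k) s -> sumn s = n -> is_partition n (sort geq s).
Proof.
move=> s_gt0 <-; apply/and3P; split.
- exact: (sort_sorted geq_total).
- by rewrite (perm_all _ (permEl (perm_sort _ _))).
- by rewrite (perm_sumn (permEl (perm_sort _ _))).
Qed.

Definition sort_partition n s (s_gt0 : all (fun k => 0 < k) s)
  (s_sum : sumn s = n) : partition_of n :=
  PartitionOf (sort_is_partition s_gt0 s_sum).

Lemma perm_sort_partition n s s_gt0 s_sum :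
  perm_eq (@sort_partition n s s_gt0 s_sum) s.
Proof. exact: permEl (perm_sort _ _). Qed.

(** Sorting turns the list [f x] into a partition, so an injection may list its parts in any order
    and need only be injective up to permutation. *)
Lemma leq_card_seq_inj n (T : finType) (A : pred T) (f : T -> seq nat) :
  (forall x, A x -> all (fun k => 0 < k) (f x)) ->
  (forall x, A x -> sumn (f x) = n) ->
  (forall x y, A x -> A y -> perm_eq (f x) (f y) -> x = y) ->
  #|A| <= npart n.
Proof.
move=> f_gt0 f_sum f_inj.
pose F x : option (partition_of n) := insub (sort geq (f x)).
have FE x : A x -> exists2 la, F x = Some la & perm_eq la (f x).
  move=> Ax; exists (sort_partition (f_gt0 x Ax) (f_sum x Ax)).
    by rewrite /F insubT ?sort_is_partition ?f_gt0 ?f_sum // => p; congr Some; apply: val_inj.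
  exact: perm_sort_partition.
have F_inj : {in A &, injective F}.
  move=> x y Ax Ay; have [la -> xla] := FE x Ax; have [mu -> ymu] := FE y Ay.
  case=> lm; apply: f_inj => //; rewrite lm in xla.
  by rewrite perm_sym in xla; apply: perm_trans xla ymu.
rewrite -(card_in_image F_inj) /npart.
have Some_inj : injective (@Some (partition_of n)) by move=> ? ? [].
rewrite -(fintype.card_image Some_inj).
apply: subset_leq_card; apply/fintype.subsetP => o /fintype.imageP[x Ax ->].
by have [la -> _] := FE x Ax; apply: fintype.image_f.
Qed.

Lemma sumn_rem (b : nat) s : b \in s -> sumn s = b + sumn (rem b s).
Proof. by move=> bs; rewrite (perm_sumn (perm_to_rem bs)). Qed.

Lemma npart_leS n : npart n <= npart n.+1.
Proof.
apply: (@leq_card_seq_inj _ _ predT (fun la : partition_of n => 1 :: la)) => //.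
- by move=> la _ /=; apply/allP => k /partition_gt0.
- by move=> la _ /=; rewrite partition_sumn add1n.
- by move=> la mu _ _; rewrite perm_cons => /partition_perm_eq.
Qed.

Lemma npart_mono : {homo npart : m n / m <= n}.
Proof. by apply: homo_leq => //; [exact: leq_trans|exact: npart_leS]. Qed.

Lemma npart0 : npart 0 = 1.
Proof.
rewrite /npart; have la0 : is_partition 0 [::] by [].
apply: (@fintype.eq_card1 _ (PartitionOf la0)) => la; apply/esym/eqP/val_inj.
case: la => -[|x s] //= /and3P[_ /andP[x0 _]].
by rewrite addn_eq0 eqn0Ngt x0.
Qed.

Lemma npart_gt0 n : 0 < npart n.
Proof. by rewrite -npart0 npart_mono. Qed.

Definition no_ones n : pred (partition_of n) := fun la => 1 \notin parts la.

(** Removing one part 1 injects the partitions of n+1 that contain a 1 into the partitions of n. *)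
Lemma npart_succ_le n : npart n.+1 <= npart n + #|@no_ones n.+1|.
Proof.
rewrite -[npart n.+1](cardC (@no_ones n.+1)) addnC leq_add2r.
apply: (@leq_card_seq_inj _ _ _ (fun la : partition_of n.+1 => rem 1 la)) => [la|la|la mu].
- move=> _; apply/allP => k /mem_rem; exact: partition_gt0.
- rewrite inE /= /no_ones unfold_in negbK => /sumn_rem.
  by rewrite partition_sumn add1n => -[].
- rewrite !inE /= /no_ones !unfold_in !negbK => la1 mu1 eq_rem.
  apply: partition_perm_eq; rewrite (perm_trans (perm_to_rem la1)) // perm_sym.
  by rewrite (perm_trans (perm_to_rem mu1)) // perm_cons perm_sym.
Qed.

(* Replacing one part b by b ones is undone by counting ones. *)
Lemma sum_distinct_parts_le n :
  \sum_(la : partition_of n | no_ones la) size (undup la) <= npart n.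
Proof.
pose A := [pred x : partition_of n * 'I_n.+1 |
             no_ones x.1 && (val x.2 \in parts x.1)].
have <- : #|A| = \sum_(la : partition_of n | no_ones la) size (undup la).
  rewrite -sum1_card (eq_bigl A) // -(pair_big_dep (@no_ones n)
    (fun la (b : 'I_n.+1) => val b \in parts la) (fun _ _ => 1)) /=.
  apply: eq_bigr => la _; rewrite sum1_card.
  have -> : size (undup la) = size [seq val b | b <- enum (fun b : 'I_n.+1 => val b \in parts la)].
    apply: perm_size; apply: uniq_perm; rewrite ?undup_uniq //.
      by rewrite map_inj_uniq ?enum_uniq //; apply: val_inj.
    move=> k; rewrite mem_undup; apply/idP/mapP => [k_la|[b]].
      have lt_kn : k < n.+1 by rewrite ltnS (partition_part_le k_la).
      by exists (Ordinal lt_kn); rewrite ?mem_enum.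
    by rewrite mem_enum => + ->.
  by rewrite size_map -cardE.
apply: (@leq_card_seq_inj _ _ _ (fun x : partition_of n * 'I_n.+1 =>
          nseq x.2 1 ++ rem (val x.2) x.1)) => [[la b]|[la b]|[la b] [mu d]].
- move=> _ /=; rewrite all_cat all_nseq orbT /=.
  by apply/allP => k /mem_rem /partition_gt0.
- move=> /andP[/= _ /sumn_rem]; rewrite partition_sumn sumn_cat sumn_nseq.
  by rewrite mul1n => <-.
- move=> /andP[/= la1 b_la] /andP[/= mu1 d_mu] eq_bd.
  have cnt (nu : partition_of n) (e : 'I_n.+1) : no_ones nu ->
     count_mem 1 (nseq e 1 ++ rem (val e) nu) = e.
    move=> nu1; rewrite count_cat count_nseq /= ?eqxx mul1n.
    by rewrite (count_memPn _) ?addn0 //; apply: contra nu1 => /mem_rem.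
  have bd : b = d.
    by apply: ord_inj; rewrite -(cnt la b la1) -[RHS](cnt mu d mu1) (permP eq_bd).
  move: eq_bd b_la; rewrite bd perm_cat2l => eq_rem b_la; congr (_, _).
  apply: partition_perm_eq; rewrite (perm_trans (perm_to_rem b_la)) // perm_sym.
  by rewrite (perm_trans (perm_to_rem d_mu)) // perm_cons perm_sym.
Qed.

(** Such a partition is recovered from the table of its distinct parts and their multiplicities. *)
Lemma card_few_distinct_parts n J :
  #|[pred la : partition_of n | size (undup la) < J]| <= (n.+1 * n.+1) ^ J.
Proof.
pose F (la : partition_of n) : {ffun 'I_J -> 'I_n.+1 * 'I_n.+1} :=
  [ffun i : 'I_J => let k := nth 0 (undup la) i in (inord k, inord (count_mem k la))].
rewrite (_ : _ ^ J = #|{ffun 'I_J -> 'I_n.+1 * 'I_n.+1}|); last first.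
  by rewrite card_ffun card_prod !card_ord.
have cnt_le (la : partition_of n) k : count_mem k la <= n.
  by rewrite (leq_trans (count_size _ _)) // partition_size.
have key (la mu : partition_of n) k : size (undup la) < J -> F la = F mu ->
    k \in parts la -> count_mem k la = count_mem k mu.
  move=> ltJ eqF k_la; have lt_i : index k (undup la) < size (undup la).
    by rewrite index_mem mem_undup.
  have /ffunP/(_ (Ordinal (ltn_trans lt_i ltJ))) := eqF; rewrite !ffunE /=.
  rewrite nth_index ?mem_undup //; set j := nth _ _ _ => -[].
  have j_le : j <= n.
    rewrite /j; case: (ltnP (index k (undup la)) (size (undup mu))) => [lt_m|/(nth_default 0)->//].
    by apply: (@partition_part_le _ mu); rewrite -mem_undup mem_nth.
  move=> /(congr1 val); rewrite /= !inordK ?ltnS ?(partition_part_le k_la) // => <-.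
  by move=> /(congr1 val); rewrite /= !inordK ?ltnS.
rewrite -(card_in_image (f := F)) ?max_card // => la mu.
rewrite !inE => la_J mu_J eqF; apply: partition_perm_eq.
apply/allP => k _; apply/eqP.
case: (boolP (k \in parts la)) => [k_la|k_la]; first exact: key.
case: (boolP (k \in parts mu)) => [k_mu|k_mu]; first by apply/esym/key.
by rewrite !(count_memPn _).
Qed.

(** With at least J distinct parts, a partition without ones contributes at least J to
    [sum_distinct_parts_le]; those with fewer are polynomially many. *)
Lemma no_ones_bound n J :
  J * #|@no_ones n| <= npart n + J * (n.+1 * n.+1) ^ J.
Proof.
have := cardID [pred la : partition_of n | size (undup la) < J] (@no_ones n).
move=> <-; rewrite mulnDr addnC leq_add //; last first.
  rewrite leq_mul2l (leq_trans _ (card_few_distinct_parts n J)) ?orbT //.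
  by apply: subset_leq_card; apply/fintype.subsetP => la; rewrite !inE => /andP[].
apply: leq_trans (sum_distinct_parts_le n).
rewrite mulnC -sum_nat_const [leqRHS](bigID [pred la : partition_of n | size (undup la) < J]) /=.
rewrite (leq_trans _ (leq_addl _ _)) //.
rewrite (eq_bigl (fun la : partition_of n => no_ones la && ~~ (size (undup la) < J))); last first.
  by move=> la; rewrite !inE andbC.
by apply: leq_sum => la /andP[_]; rewrite -leqNgt.
Qed.

(** The multiplicities of the k parts 2, ..., k+1 can be chosen independently up to
    [n %/ (k * k.+1)], ones filling up the rest. *)
Lemma npart_superpoly k n : (n %/ (k * k.+1)).+1 ^ k <= npart n.
Proof.
set s := n %/ _.
rewrite (_ : _ ^ k = #|{ffun 'I_k -> 'I_s.+1}|); last first.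
  by rewrite card_ffun !card_ord.
pose G (m : {ffun 'I_k -> 'I_s.+1}) := flatten [seq nseq (m i) i.+2 | i <- enum 'I_k].
have sumG m : sumn (G m) <= n.
  rewrite sumn_flatten -map_comp sumnE big_map big_enum /=.
  have -> : \sum_(i < k) sumn (nseq (m i) i.+2) = \sum_(i < k) i.+2 * m i.
    by apply: eq_bigr => i _; rewrite sumn_nseq.
  apply: leq_trans (_ : \sum_(i < k) k.+1 * s <= _).
    by apply: leq_sum => i _; apply: leq_mul; [exact: ltn_ord|rewrite -ltnS].
  by rewrite sum_nat_const card_ord mulnA mulnC leq_trunc_div.
have cntG m (i : 'I_k) : count_mem i.+2 (G m) = m i.
  rewrite count_flatten -map_comp sumnE big_map big_enum /= (bigD1 i) //=.
  rewrite count_nseq /= ?eqxx mul1n big1 ?addn0 // => j ji.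
  by rewrite count_nseq /= eqSS eqSS (negPf (ji : (j != i :> nat))).
apply: (@leq_card_seq_inj _ _ _ (fun m => nseq (n - sumn (G m)) 1 ++ G m)) => [m|m|m m'] _.
- rewrite all_cat all_nseq orbT /=; apply/allP => x /flattenP[u /mapP[i _ ->]].
  by move=> /nseqP[->].
- by rewrite sumn_cat sumn_nseq mul1n subnK.
- move=> _ /permP eq_m; apply/ffunP => i; apply: val_inj.
  have := eq_m (pred1 i.+2); rewrite !count_cat !count_nseq /= !mul0n.
  by rewrite !cntG.
Qed.

(** * Hooks and beta-sets *)

Definition conj_part (s : seq nat) (j : nat) := count (fun k => j < k) s.

Lemma sorted_geq_le x s k : path geq x s -> nth 0 s k <= x.
Proof.
move=> xs; case: (ltnP k (size s)) => [lt_k|/(nth_default 0)->//].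
by have /allP/(_ _ (mem_nth 0 lt_k)) := order_path_min geq_trans xs.
Qed.

Lemma conj_partP s j k : sorted geq s -> (j < nth 0 s k) = (k < conj_part s j).
Proof.
rewrite /conj_part; elim: s k => [|x s IHs] k /= xs; first by rewrite nth_nil.
have sorted_s := path_sorted xs.
case: (ltnP j x) => [jx|xj]; first by case: k => [|k] /=; rewrite ?jx // IHs.
have all_le l : nth 0 s l <= j by apply: leq_trans (sorted_geq_le _ xs) xj.
have /eqP-> : count (fun k => j < k) s == 0.
  rewrite eqn0Ngt -has_count; apply/hasPn => y /(nthP 0)[l _ <-].
  by rewrite -leqNgt.
by case: k => [|k] /=; apply/negbTE; rewrite -leqNgt.
Qed.

Lemma count_cells (a : pred (nat * nat)) s :
  count a (cells s) =
  \sum_(0 <= k < size s) count (fun l => a (k, l)) (iota 0 (nth 0 s k)).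
Proof.
rewrite /cells count_flatten -map_comp sumnE big_map /index_iota subn0.
by apply: eq_bigr => k _; rewrite /= count_map.
Qed.

Lemma count_geq_iota j n : count (fun l => j <= l) (iota 0 n) = n - j.
Proof.
case: (leqP n j) => [nj|/ltnW jn].
  rewrite (eqP (_ : n - j == 0)) ?subn_eq0 //; apply/eqP; rewrite -leqn0 leqNgt.
  by rewrite -has_count; apply/hasPn => l; rewrite mem_iota add0n -ltnNge => /andP[_ /leq_trans->].
rewrite -{1}(subnKC jn) iotaD count_cat add0n.
rewrite (eq_in_count (a2 := pred0)) ?count_pred0; last first.
  by move=> l; rewrite mem_iota add0n => /andP[_]; rewrite ltnNge => /negbTE.
rewrite (eq_in_count (a2 := predT)) ?count_predT ?size_iota //.
by move=> l; rewrite mem_iota => /andP[].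
Qed.

Lemma sum_lt_index_iota i m n : m <= n -> i <= m ->
  \sum_(i <= k < n) (k < m) = m - i.
Proof.
move=> mn im; rewrite (@big_cat_nat _ _ _ m) //=.
rewrite [X in _ + X]big_nat [X in _ + X]big1 ?addn0; last first.
  by move=> k /andP[mk _]; rewrite ltnNge mk.
rewrite (eq_big_nat _ _ (F2 := fun=> 1)) ?sum_nat_const_nat ?muln1 //.
by move=> k /andP[_ ->].
Qed.

(** Arm plus leg plus one, written without truncated subtraction. *)
Lemma hook_numberE s i j : sorted geq s -> j < nth 0 s i ->
  hook_number s (i, j) + (i + j).+1 = nth 0 s i + conj_part s j.
Proof.
move=> sorted_s j_lt; rewrite /hook_number count_cells /=.
have i_lt : i < size s.
  by rewrite ltnNge; apply/negP => /(nth_default 0) s0; rewrite s0 in j_lt.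
have ij : i < conj_part s j by rewrite -conj_partP.
rewrite (@big_cat_nat _ _ _ i) //= 1?ltnW //.
rewrite [X in X + _ + _]big_nat [X in X + _ + _]big1 ?add0n; last first.
  move=> k /andP[_ ki]; rewrite (eq_count (a2 := pred0)) ?count_pred0 // => l.
  by rewrite /= (ltn_eqF ki) (leqNgt i k) ki andbF.
rewrite (big_ltn i_lt) eqxx /=.
rewrite (eq_count (a2 := fun l => j <= l)); last first.
  by move=> l /=; rewrite leqnn andbT; case: eqP => [->|]; rewrite ?leqnn ?orbF.
rewrite count_geq_iota (eq_big_nat _ _ (F2 := fun k => nat_of_bool (k < conj_part s j))).
  rewrite sum_lt_index_iota //; last exact: count_size.
  by move: j_lt ij; lia.
move=> k /andP[ik _]; rewrite -conj_partP //.
rewrite (eq_count (a2 := pred1 j)) ?count_uniq_mem ?iota_uniq ?mem_iota //.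
by move=> l /=; rewrite (gtn_eqF ik) (ltnW ik) andbT.
Qed.

(* First-column hook lengths of s padded with zeros to N rows; the row length *)
(* of row i is the number of gaps below beta_nth N s i.                       *)
Definition beta_nth N s i := nth 0 s i + (N - i.+1).
Definition beta N s := [seq beta_nth N s i | i <- iota 0 N].

Lemma sorted_nth_le s i j : sorted geq s -> i <= j -> nth 0 s j <= nth 0 s i.
Proof.
move=> ss ij; case: (ltnP j (size s)) => [lt_j|/(nth_default 0)->//].
apply: (sorted_leq_nth geq_trans _ 0 ss) => //; first exact: leqnn.
by rewrite inE; apply: leq_ltn_trans ij lt_j.
Qed.

Lemma beta_nth_lt N s i j : sorted geq s -> i < j -> j < N ->
  beta_nth N s j < beta_nth N s i.
Proof.
by rewrite /beta_nth => ss ij jN; have := sorted_nth_le ss (ltnW ij); lia.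
Qed.

Lemma beta_nth_inj N s : sorted geq s -> {in gtn N &, injective (beta_nth N s)}.
Proof.
move=> ss i j; rewrite !inE => iN jN eq_ij; case: (ltngtP i j) => // ltij.
  by have := beta_nth_lt ss ltij jN; rewrite eq_ij ltnn.
by have := beta_nth_lt ss ltij iN; rewrite eq_ij ltnn.
Qed.

(** Column j of row i corresponds to the gap [N + j - conj_part s j], whose distance to
    [beta_nth N s i] is the hook number of (i, j). *)
Lemma beta_gaps N s i : sorted geq s -> size s <= N -> i < N ->
  perm_eq [seq y <- iota 0 (beta_nth N s i) | y \notin beta N s]
          [seq N + j - conj_part s j | j <- iota 0 (nth 0 s i)].
Proof.
move=> ss sN iN; rewrite perm_sym.
have cjN j : conj_part s j <= N by apply: leq_trans (count_size _ _) sN.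
have cj_mono j j' : j <= j' -> conj_part s j' <= conj_part s j.
  by move=> jj'; apply: sub_count => k /=; apply: leq_ltn_trans.
have uniqR : uniq [seq N + j - conj_part s j | j <- iota 0 (nth 0 s i)].
  rewrite map_inj_in_uniq ?iota_uniq // => j j' _ _ eq_jj.
  have := cjN j; have := cjN j'; move: eq_jj.
  by case: (ltngtP j j') => // ltj; have := cj_mono _ _ (ltnW ltj); lia.
have [||_ eqi] := @uniq_min_size _ [seq N + j - conj_part s j | j <- iota 0 (nth 0 s i)]
   [seq y <- iota 0 (beta_nth N s i) | y \notin beta N s] uniqR.
- move=> y /mapP[j]; rewrite mem_iota add0n => /andP[_ j_lt] ->.
  have ij : i < conj_part s j by rewrite -conj_partP.
  rewrite mem_filter mem_iota add0n leq0n /=; apply/andP; split; last first.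
    by rewrite /beta_nth; have := cjN j; lia.
  apply/negP => /mapP[k]; rewrite mem_iota add0n => /andP[_ kN]; rewrite /beta_nth.
  have := conj_partP j k ss; have := cjN j.
  by case: (ltnP j (nth 0 s k)) => h1 h2 h3; move/esym: h3; lia.
(* The N - i - 1 later beta-numbers lie below [beta_nth N s i], which leaves at most [nth 0 s i]
   gaps; with the inclusion just shown this forces equality. *)
- rewrite size_map size_iota size_filter.
  have := count_predC (mem (beta N s)) (iota 0 (beta_nth N s i)).
  rewrite size_iota => cntE.
  suff : N - i.+1 <= count (mem (beta N s)) (iota 0 (beta_nth N s i)).
    by move: cntE; rewrite /beta_nth; set a := count _ _; set b := count _ _; lia.
  rewrite -size_filter -(size_iota i.+1 (N - i.+1)) -(size_map (beta_nth N s)).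
  apply: uniq_leq_size.
    rewrite map_inj_in_uniq ?iota_uniq // => j j'; rewrite !mem_iota => hj hj'.
    by apply: beta_nth_inj => //; rewrite inE; lia.
  move=> y /mapP[k]; rewrite mem_iota => hk ->.
  rewrite mem_filter mem_iota /= add0n beta_nth_lt ?andbT //; try lia.
  by apply: map_f; rewrite mem_iota; lia.
apply: uniq_perm; rewrite ?filter_uniq ?iota_uniq //.
Qed.

Lemma row_hooks N t s i : sorted geq s -> size s <= N -> i < N ->
  count (fun j => t %| hook_number s (i, j)) (iota 0 (nth 0 s i)) =
  count (fun y => (y \notin beta N s) && (t %| beta_nth N s i - y))
        (iota 0 (beta_nth N s i)).
Proof.
move=> ss sN iN.
have -> : count (fun y => (y \notin beta N s) && (t %| beta_nth N s i - y))
   (iota 0 (beta_nth N s i)) =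
   count (fun y => t %| beta_nth N s i - y)
     [seq y <- iota 0 (beta_nth N s i) | y \notin beta N s].
  by rewrite count_filter; apply: eq_count => y /=; rewrite andbC.
rewrite (permP (beta_gaps ss sN iN)) count_map; apply: eq_in_count => j.
rewrite mem_iota add0n => /andP[_ j_lt] /=; congr (_ %| _).
have := hook_numberE ss j_lt; have ij : i < conj_part s j by rewrite -conj_partP.
have cjN : conj_part s j <= N by apply: leq_trans (count_size _ _) sN.
by rewrite /beta_nth; lia.
Qed.

Lemma size_t_hooks N t s : sorted geq s -> size s <= N ->
  size (t_hooks t s) =
  \sum_(x <- beta N s) count (fun y => (y \notin beta N s) && (t %| x - y)) (iota 0 x).
Proof.
move=> ss sN; rewrite /t_hooks size_filter count_map count_cells big_map.
rewrite [RHS](_ : _ = \sum_(0 <= i < N) count (fun j => t %| hook_number s (i, j)) (iota 0 (nth 0 s i))); last first.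
  rewrite /index_iota subn0 !big_seq; apply: eq_bigr => i.
  by rewrite mem_iota add0n => /andP[_ iN]; rewrite (row_hooks t ss sN iN).
rewrite [RHS](@big_cat_nat _ _ _ (size s)) //= [X in _ + X]big_nat.
rewrite [X in _ + X]big1 ?addn0 // => i /andP[si _].
by rewrite nth_default.
Qed.

(** * Partitions of n as subsets of an interval with fixed cardinality and weight *)

Definition wt M (X : {set 'I_M}) : nat := \sum_(x in X) x.
(* Hooks correspond to pairs y < x with x in the beta-set and y outside it,   *)
(* the hook number being x - y.                                               *)
Definition tinv t M (X : {set 'I_M}) : nat :=
  \sum_(x in X) \sum_(y : 'I_M) [&& y \notin X, y < x & t %| x - y].
Definition beta_set N M n (la : partition_of n) : {set 'I_M} :=
  finset (fun x : 'I_M => val x \in beta N la).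

Lemma partition_sorted n (la : partition_of n) : sorted geq la.
Proof. by case: la => s /= /and3P[]. Qed.

Lemma beta_uniq N s : sorted geq s -> uniq (beta N s).
Proof.
move=> ss; rewrite map_inj_in_uniq ?iota_uniq // => i j.
by rewrite !mem_iota !add0n => hi hj; apply: beta_nth_inj.
Qed.

Section BetaSet.
Variables (N M n : nat).
Hypotheses (le_nN : n <= N) (le_NM : n + N <= M).
Implicit Types la mu : partition_of n.

Let size_le la : size la <= N.
Proof. exact: leq_trans (partition_size la) le_nN. Qed.

Let beta_lt la x : x \in beta N la -> x < M.
Proof.
move=> /mapP[i]; rewrite mem_iota add0n => /andP[_ iN] ->; rewrite /beta_nth.
suff : nth 0 la i <= n by lia.
case: (ltnP i (size la)) => [lt_i|/(nth_default 0)->//].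
by apply: (@partition_part_le _ la); rewrite mem_nth.
Qed.

Lemma sum_beta_set la (F : nat -> nat) :
  \sum_(x in beta_set N M la) F x = \sum_(x <- beta N la) F x.
Proof.
rewrite -big_enum /= -(big_map val predT F); apply: perm_big; apply: uniq_perm.
- by rewrite map_inj_uniq ?enum_uniq //; apply: val_inj.
- exact/beta_uniq/partition_sorted.
move=> x; apply/mapP/idP => [[y]|x_la].
  by rewrite mem_enum finset.inE => + ->.
by exists (Ordinal (beta_lt x_la)); rewrite ?mem_enum ?finset.inE.
Qed.

Lemma card_beta_set la : #|beta_set N M la| = N.
Proof.
by rewrite -sum1_card (sum_beta_set la (fun=> 1)) sum1_size size_map size_iota.
Qed.

Lemma wt_beta_set la : wt (beta_set N M la) = n + 'C(N, 2).
Proof.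
rewrite /wt (sum_beta_set la id) big_map big_split /=; congr (_ + _).
  rewrite -[RHS](partition_sumn la) -(subnKC (size_le la)) iotaD big_cat /=.
  rewrite [X in _ + X]big_seq [X in _ + X]big1 ?addn0; last first.
    by move=> i; rewrite mem_iota add0n => /andP[? _]; rewrite nth_default.
  by rewrite sumnE -[in RHS](mkseq_nth 0 la) big_map.
rewrite -bin2_sum big_nat_rev /= /index_iota subn0 !big_seq.
by apply: eq_bigr => i; rewrite mem_iota.
Qed.

Lemma tinv_beta_set t la : tinv t (beta_set N M la) = size (t_hooks t la).
Proof.
rewrite (size_t_hooks t (partition_sorted la) (size_le la)).
have eqF x : x < M -> count (fun y => (y \notin beta N la) && (t %| x - y)) (iota 0 x) =
   \sum_(y < M) [&& val y \notin beta N la, y < x & t %| x - y].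
  move=> xM; rewrite -sum1_count big_mkcond -/(index_iota 0 M).
  rewrite -(big_mkord predT (fun y => [&& y \notin beta N la, y < x & t %| x - y] : nat)).
  rewrite (@big_cat_nat _ _ _ x) ?(ltnW xM) //= [X in _ + X]big_nat [X in _ + X]big1.
    rewrite addn0 /index_iota subn0 !big_seq; apply: eq_bigr => y.
    by rewrite mem_iota add0n => /andP[_ ->]; case: ifP.
  by move=> y /andP[xy _]; rewrite ltnNge xy andbF.
rewrite -(sum_beta_set la (fun x => count (fun y => (y \notin beta N la) && (t %| x - y)) (iota 0 x))).
apply: eq_bigr => x _; rewrite eqF //.
by apply: eq_bigr => y _; rewrite finset.inE.
Qed.

Let padded la : parts la = [seq x <- mkseq (nth 0 la) N | 0 < x].
Proof.
rewrite /mkseq -(subnKC (size_le la)) iotaD map_cat filter_cat.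
rewrite -/(mkseq (nth 0 la) (size la)) mkseq_nth [X in _ ++ X](_ : _ = [::]); last first.
  apply/eqP; rewrite -[_ == _]negbK -has_filter -all_predC all_map.
  by apply/allP => i; rewrite mem_iota => /andP[? _] /=; rewrite nth_default.
rewrite cats0; apply/esym/all_filterP/allP => k; exact: partition_gt0.
Qed.

Lemma beta_sorted s : sorted geq s -> sorted gtn (beta N s).
Proof.
move=> ss; apply/(sortedP 0) => i; rewrite size_map size_iota => iN.
rewrite !(nth_map 0) ?size_iota ?nth_iota ?add0n //; try exact: ltnW.
exact: beta_nth_lt.
Qed.

Lemma beta_set_inj : injective (@beta_set N M n).
Proof.
move=> la mu eq_lm; have eqb : beta N la = beta N mu.
  apply: (@irr_sorted_eq _ gtn); rewrite ?beta_sorted ?partition_sorted //.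
  - by move=> x y z xy yz; apply: ltn_trans yz xy.
  - by move=> x; rewrite /gtn /= ltnn.
  move=> x; apply/idP/idP => x_in; move/setP/(_ (Ordinal (beta_lt x_in))): eq_lm.
    by rewrite !finset.inE /= x_in.
  by rewrite !finset.inE /= x_in.
apply: val_inj; rewrite /= (padded la) (padded mu); congr [seq _ <- _ | _].
apply/eq_in_map => i; rewrite mem_iota add0n => /andP[_ iN].
have := congr1 (fun s => nth 0 s i) eqb.
by rewrite /beta !(nth_map 0) ?size_iota // nth_iota // /beta_nth => /addIn.
Qed.

Let path_gtn_size x s : path gtn x s -> size s <= x.
Proof. by elim: s x => [|y s IHs] x //= /andP[yx /IHs]; move: yx; rewrite /gtn /=; lia. Qed.

Let sorted_gtn_nth s i : sorted gtn s -> i < size s -> size s - i.+1 <= nth 0 s i.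
Proof.
elim: s i => [|x s IHs] [|i] //= xs; first by move=> _; rewrite subn1; exact: path_gtn_size.
rewrite ltnS subSS; apply: IHs; exact: path_sorted xs.
Qed.

Let nth_filter_pos s i : sorted geq s -> nth 0 [seq x <- s | 0 < x] i = nth 0 s i.
Proof.
elim: s i => [|x s IHs] i //= xs; case: (posnP x) => [x0|x_gt0] /=; last first.
  by case: i => //= i; apply: IHs; exact: path_sorted xs.
have s0 j : nth 0 s j = 0 by apply/eqP; rewrite -leqn0 -[leqRHS]x0 sorted_geq_le.
by rewrite IHs ?(path_sorted xs) // s0; case: i => //= i; rewrite ?x0 ?s0.
Qed.

(** Subtracting the staircase N-1, ..., 0 from the elements in decreasing order gives the parts,
    padded with zeros. *)
Lemma beta_set_surj (X : {set 'I_M}) : #|X| = N -> wt X = n + 'C(N, 2) ->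
  exists la : partition_of n, beta_set N M la = X.
Proof.
move=> cardX wtX; pose e := rev [seq val x | x <- enum X].
have size_e : size e = N by rewrite size_rev size_map -cardE.
have sorted_e : sorted gtn e.
  rewrite rev_sorted; apply: (subseq_sorted ltn_trans) (iota_ltn_sorted 0 M).
  by rewrite -val_enum_ord map_subseq // {1}/enum_mem -enumT filter_subseq.
pose l i := nth 0 e i - (N - i.+1).
have e_ge i : i < N -> N - i.+1 <= nth 0 e i.
  by move=> iN; rewrite -{1}size_e sorted_gtn_nth ?size_e.
have sorted_l : sorted geq (mkseq l N).
  apply/(sortedP 0) => i; rewrite size_mkseq => iN; rewrite !nth_mkseq ?(ltnW iN) //.
  have := (sortedP 0 sorted_e) i; rewrite size_e => /(_ iN).
  by rewrite /l /gtn /geq /=; lia.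
pose s := [seq x <- mkseq l N | 0 < x].
have sum_s : sumn s = n.
  apply: (@addIn 'C(N, 2)); rewrite -wtX -bin2_sum.
  have -> : wt X = \sum_(0 <= i < N) nth 0 e i.
    rewrite /wt -big_enum /= -(big_map val predT id) -[N in RHS]size_e -(big_nth 0 predT id).
    by apply: perm_big; rewrite perm_sym perm_rev.
  rewrite sumnE big_filter big_mkcond /= big_map.
  rewrite [X in _ + X = _]big_nat_rev /= /index_iota subn0 -big_split /=.
  rewrite !big_seq; apply: eq_bigr => i; rewrite mem_iota add0n => /andP[_ iN].
  by have := e_ge i iN; rewrite /l; case: ifP; lia.
have s_part : is_partition n s.
  apply/and3P; split; last exact/eqP.
    exact: sorted_filter geq_trans _ _ sorted_l.
  exact: filter_all.
exists (PartitionOf s_part); apply/setP => x; rewrite finset.inE /=.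
have -> : beta N s = e.
  apply: (@eq_from_nth _ 0); rewrite size_map size_iota ?size_e // => i iN.
  rewrite (nth_map 0) ?size_iota // nth_iota // add0n /beta_nth /s.
  by rewrite nth_filter_pos // nth_mkseq // /l subnK ?e_ge.
by rewrite mem_rev mem_map ?mem_enum //; exact: val_inj.
Qed.

(** The function [g] is arbitrary so that p(n) and the signed count are handled together. *)
Lemma sum_t_hooks (V : nmodType) t (g : nat -> V) :
  (\sum_(la : partition_of n) g (size (t_hooks t la)) =
   \sum_(X : {set 'I_M} | (#|X| == N) && (wt X == n + 'C(N, 2))%N) g (tinv t X))%R.
Proof.
pose im := (@beta_set N M n @: [set: partition_of n])%SET.
rewrite [RHS](eq_bigl (fun X => X \in im)); last first.
  move=> X; apply/andP/imsetP => [[/eqP cX /eqP wX]|[la _ ->]].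
    have [la la_X] := beta_set_surj cX wX; exists la; last exact: esym.
    by rewrite finset.inE.
  by rewrite card_beta_set wt_beta_set !eqxx.
rewrite big_imset /=; last by move=> ? ? _ _; apply: beta_set_inj.
by apply: eq_big => [la|la _]; rewrite ?finset.inE ?tinv_beta_set.
Qed.

Lemma card_beta_sets :
  #|[pred X : {set 'I_M} | (#|X| == N) && (wt X == n + 'C(N, 2))]| = npart n.
Proof.
rewrite /npart -!sum1_card; exact: esym (sum_t_hooks (V := nat) 1 (fun=> 1)).
Qed.

End BetaSet.

Lemma sum_ltn_ord M (x : 'I_M) : \sum_(y < M) (y < x) = x.
Proof.
rewrite -(big_mkord predT (fun y => (y < x) : nat)).
by rewrite sum_lt_index_iota ?subn0 // ltnW.
Qed.

Lemma sum_pairs_lt M (X : {set 'I_M}) :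
  \sum_(x in X) \sum_(y in X) (y < x) = 'C(#|X|, 2).
Proof.
set S := LHS; have : S + S + #|X| = #|X| * #|X|.
  rewrite {2}/S exchange_big /= /S -big_split /= -[X in _ + X = _]sum1_card -big_split /=.
  rewrite -sum_nat_const; apply: eq_bigr => x xX.
  rewrite -big_split /= -[RHS]sum1_card (bigD1 x xX) /= [RHS](bigD1 x xX) /=.
  rewrite ltnn addn0 add0n addnC; congr (_ + _); apply: eq_bigr => y /andP[_ yx].
  by case: (ltngtP y x) yx => // /val_inj->; rewrite eqxx.
rewrite bin2; case: #|X| => [|m]; first by lia.
move=> eqS; have -> : m.+1 * m.+1.-1 = S.*2 by rewrite -addnn /=; move: eqS; lia.
by rewrite half_double.
Qed.

(** There are x positions below x, each a gap or an element of [X]. Hence [tinv 1] of a beta-set is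
    the size of its partition. *)
Lemma tinv1_wt M (X : {set 'I_M}) : tinv 1 X + 'C(#|X|, 2) = wt X.
Proof.
rewrite -sum_pairs_lt /tinv -big_split /=; apply: eq_bigr => x _.
rewrite -[RHS](sum_ltn_ord x) [X in _ + X]big_mkcond -big_split /=.
by apply: eq_bigr => y _; rewrite dvd1n andbT; case: (y \in X) => /=; lia.
Qed.

(** * The abacus: cutting a bead set into t runners *)

Section Split.
Variables (t K : nat).

Lemma idx_subproof (i : 'I_t) (a : 'I_K) : a * t + i < K * t.
Proof. by have := ltn_ord i; have := ltn_ord a; nia. Qed.
Definition idx i a : 'I_(K * t) := Ordinal (idx_subproof i a).

Lemma idx_bij : bijective (fun p : 'I_t * 'I_K => idx p.1 p.2).
Proof.
apply: inj_card_bij; last by rewrite card_prod !card_ord mulnC.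
move=> [i a] [j b] /(congr1 val) /= eq_ab.
have t_gt0 : 0 < t by apply: leq_ltn_trans (ltn_ord i).
have eqi : i = j.
  apply: val_inj; have := congr1 (modn^~ t) eq_ab.
  by rewrite /= !modnMDl !modn_small.
congr (_, _) => //; apply: val_inj; move: eq_ab; rewrite eqi => /addIn /eqP.
by rewrite eqn_pmul2r // => /eqP.
Qed.

Lemma sum_idx (F : 'I_(K * t) -> nat) : \sum_x F x = \sum_i \sum_a F (idx i a).
Proof. by rewrite pair_big (reindex _ (onW_bij _ idx_bij)). Qed.

Definition split_set (X : {set 'I_(K * t)}) : {ffun 'I_t -> {set 'I_K}} :=
  [ffun i => finset (fun a => idx i a \in X)].

Lemma split_set_bij : bijective split_set.
Proof.
apply: inj_card_bij => [X Y eqXY|]; last first.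
  rewrite card_ffun -!cardsT -!powersetT !card_powerset !cardsT !card_ord.
  by rewrite expnM.
apply/setP => x; have [f _ fK] := idx_bij.
rewrite -(fK x); move/ffunP/(_ (f x).1): eqXY; rewrite !ffunE => /setP/(_ (f x).2).
by rewrite !finset.inE.
Qed.

Lemma sum_split (X : {set 'I_(K * t)}) (F : 'I_(K * t) -> nat) :
  \sum_(x in X) F x = \sum_i \sum_(a in split_set X i) F (idx i a).
Proof.
rewrite big_mkcond sum_idx; apply: eq_bigr => i _; rewrite [RHS]big_mkcond /=.
by apply: eq_bigr => a _; rewrite ffunE finset.inE.
Qed.

Lemma card_split (X : {set 'I_(K * t)}) : #|X| = \sum_i #|split_set X i|.
Proof.
by rewrite -sum1_card sum_split; apply: eq_bigr => i _; rewrite sum1_card.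
Qed.

Lemma wt_split (X : {set 'I_(K * t)}) : wt X = \sum_i (t * wt (split_set X i) + i * #|split_set X i|).
Proof.
rewrite /wt sum_split; apply: eq_bigr => i _ /=.
by rewrite big_split /= sum_nat_const big_distrr mulnC /=; under eq_bigr do rewrite mulnC.
Qed.

(** Two positions differ by a multiple of t exactly when they share a runner, and there every
    inversion counts: the right side is the size of the t-quotient. *)
Lemma tinv_split (X : {set 'I_(K * t)}) : tinv t X = \sum_i tinv 1 (split_set X i).
Proof.
rewrite /tinv sum_split; apply: eq_bigr => i _; apply: eq_bigr => a a_in.
rewrite sum_idx (bigD1 i) //= [X in _ + X]big1 ?addn0; last first.
  move=> j ji; apply: big1 => b _; apply/eqP; rewrite eqb0.
  apply: contra ji => /and3P[_ /ltnW lt_ba]; rewrite -eqn_mod_dvd //=.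
  by rewrite !modnMDl !modn_small // => /eqP /val_inj->.
apply: eq_bigr => b _; rewrite ffunE finset.inE dvd1n andbT /=.
rewrite ltn_add2r subnDr -mulnBl dvdn_mull // andbT ltn_mul2r.
by rewrite (leq_ltn_trans _ (ltn_ord i)).
Qed.

End Split.

(* Number of t-tuples of partitions of total size w. *)
Fixpoint pt (t w : nat) : nat :=
  if t is t'.+1 then \sum_(j < w.+1) npart j * pt t' (w - j) else w == 0.

(** The generating functions are only assumed correct up to degree w, because subsets of a bounded
    interval represent all partitions only up to a bounded size. *)
Lemma coef_prod_pt w t (P : 'I_t -> {poly int}) :
  (forall i k, k <= w -> ((P i)`_k = (npart k)%:Z)%R) ->
  forall k, k <= w -> ((\prod_i P i)`_k = (pt t k)%:Z)%R.
Proof.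
elim: t P => [|t IHt] P PE k kw; first by rewrite big_ord0 coef1 /=; case: (k == 0).
rewrite big_ord_recl coefM /= -natz natr_sum; apply: eq_bigr => j _.
have jk : j <= k by rewrite -ltnS.
rewrite PE ?(leq_trans jk) // IHt ?(leq_trans (leq_subr _ _)) //; last by move=> i; apply: PE.
by rewrite natz PoszM.
Qed.

(** The product over the runners of the generating polynomials of [tinv 1]; the two bounds are what
    [card_beta_sets] requires on each runner. *)
Lemma card_families t K w (d : 'I_t -> nat) :
  (forall i, w <= d i) -> (forall i, w + d i <= K) ->
  #|[pred F : {ffun 'I_t -> {set 'I_K}} |
      [forall i, #|F i| == d i] && (\sum_i tinv 1 (F i) == w)]| = pt t w.
Proof.
move=> wd dK.
pose P i : {poly int} := (\sum_(Y : {set 'I_K} | #|Y| == d i) 'X^(tinv 1 Y))%R.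
have PE i k : k <= w -> ((P i)`_k = (npart k)%:Z)%R.
  move=> kw; rewrite coef_sum -(@card_beta_sets (d i) K k); last 2 first.
  - exact: leq_trans (wd i).
  - by apply: leq_trans (dK i); rewrite leq_add2r.
  rewrite -sum1_card -natz natr_sum [RHS](eq_bigl (fun Y : {set 'I_K} =>
    (#|Y| == d i) && (tinv 1 Y == k))); last first.
    move=> Y; rewrite inE; case: eqP => //= <-.
    by rewrite -tinv1_wt eqn_add2r.
  rewrite big_mkcondr /=; apply: eq_bigr => Y _.
  by rewrite coefXn eq_sym; case: eqP.
apply/eqP; rewrite -eqz_nat -(coef_prod_pt PE (leqnn w)).
rewrite bigA_distr_big_dep coef_sum -sum1_card -natz natr_sum big_mkcondr /=.
apply/eqP; apply: eq_big => [F|F _].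
  by apply/forallP/familyP => h i; exact: (h i).
by rewrite prodrXr coefXn eq_sym; case: eqP.
Qed.

(** * Slow growth of p and of the number of t-tuples of partitions *)

Lemma npart_gt_poly A k : exists n0, forall n, n0 <= n -> A * n.+1 ^ k <= npart n.
Proof.
pose q := k.+1 * k.+2; have q_gt0 : 0 < q by [].
exists (A * q ^ k.+1) => n n_ge.
have le1 : n.+1 <= q * (n %/ q).+1 by rewrite mulnC ltn_ceil.
have le2 : n.+1 ^ k.+1 <= q ^ k.+1 * npart n.
  apply: leq_trans (leq_mul (leqnn _) (npart_superpoly k.+1 n)).
  by rewrite -expnMn leq_exp2r.
rewrite -(@leq_pmul2l (q ^ k.+1)) ?expn_gt0 ?q_gt0 //; apply: leq_trans le2.
by rewrite mulnA [_ * A]mulnC (expnS n.+1) leq_mul2r (leq_trans n_ge) ?orbT // leqnSn.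
Qed.

(** For positive [a]: the ratio of consecutive values has upper limit at most 1. *)
Definition slow (a : nat -> nat) :=
  forall J, exists w0, forall w, w0 <= w -> J * a w.+1 <= J.+1 * a w.

Lemma npart_slow : slow npart.
Proof.
(* The factor 2 pays for the polynomial term: eventually both terms on the right of [no_ones_bound]
   are at most p(w+1). *)
move=> J; pose L := (2 * J.+1)%N.
have [n0 n0P] := npart_gt_poly L (2 * L); exists n0 => w w_ge.
have := npart_succ_le w; have := no_ones_bound w.+1 L.
have := n0P w.+1 (leqW w_ge); rewrite mulnn -expnM.
move: (_ ^ _) #|_| (npart w) (npart w.+1) => X u p p'; rewrite /L; nia.
Qed.

(** Each step costs a factor (J+1)/J, and Bernoulli's inequality gives (J/(J+1))^j >= 1 -
    j/(J+1). *)
Lemma slow_bernoulli a J w0 : (forall w, w0 <= w -> J * a w.+1 <= J.+1 * a w) ->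
  forall j w, w0 <= w -> j <= J -> (J.+1 - j) * a (w + j) <= J.+1 * a w.
Proof.
move=> aP; elim=> [|j IHj] w w_ge jJ; first by rewrite addn0 subn0.
have := IHj w.+1 (leqW w_ge) (ltnW jJ); have := aP w w_ge.
rewrite addSnnS; move: (a w) (a w.+1) (a (w + j.+1)) => x y z h1 h2.
rewrite -(@leq_pmul2l J.+1) //; apply: leq_trans (_ : J * (J.+1 * y) <= _); last by nia.
by apply: leq_trans (leq_mul (leqnn J) h2); nia.
Qed.

Lemma slow_half a m : slow a -> {homo a : w w' / w <= w'} ->
  exists w0, forall w j, w0 <= w -> j <= m -> a w <= 2 * a (w - j).
Proof.
(* With J = 2m+1 and j <= m, the factor J+1-j is at least (J+1)/2. *)
move=> slow_a mono_a; have [w0 w0P] := slow_a (2 * m).+1.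
exists (w0 + m) => w j w_ge jm.
have wj : w0 <= w - j by lia.
have := slow_bernoulli w0P wj (_ : j <= (2 * m).+1); rewrite subnK; last by lia.
move=> /(_ ltac:(lia)); move: (a w) (a (w - j)) => x y h.
by rewrite -(@leq_pmul2l m.+1) //; nia.
Qed.

(** The recursion of [pt], isolated so that slowness passes from t to t+1. *)
Definition conv_npart (a : nat -> nat) w := \sum_(j < w.+1) npart j * a (w - j).

Lemma conv_npartS a w : conv_npart a w.+1 =
  a w.+1 + \sum_(j < w.+1) npart j.+1 * a (w - j).
Proof. by rewrite /conv_npart big_ord_recl npart0 mul1n. Qed.

Lemma conv_npart_mono a : {homo conv_npart a : w w' / w <= w'}.
Proof.
apply: homo_leq => //; first exact: leq_trans.
move=> w; rewrite conv_npartS (leq_trans _ (leq_addl _ _)) // leq_sum // => j _.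
by rewrite leq_mul2r npart_leS orbT.
Qed.

(** Each of the first 2D terms of the convolution is at least half of a(w+1). *)
Lemma conv_npart_dominates a D : slow a -> {homo a : w w' / w <= w'} ->
  exists w0, forall w, w0 <= w -> D * a w.+1 <= conv_npart a w.
Proof.
move=> slow_a mono_a; have [w0 w0P] := slow_half (2 * D).+1 slow_a mono_a.
exists (w0 + 2 * D) => w w_ge; rewrite /conv_npart.
rewrite -(big_mkord predT (fun j => npart j * a (w - j))).
rewrite (@big_cat_nat _ _ _ (2 * D)) //=; last by lia.
rewrite (leq_trans _ (leq_addr _ _)) // -(@leq_pmul2l 2) //.
apply: leq_trans (_ : \sum_(0 <= j < 2 * D) a w.+1 <= _).
  by rewrite sum_nat_const_nat subn0 mulnA.
rewrite big_distrr /= big_nat [leqRHS]big_nat leq_sum // => j /andP[_ jD].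
have := w0P w.+1 j.+1 _ _; rewrite subSS => /(_ ltac:(lia) ltac:(lia)) h.
by apply: leq_trans h _; rewrite leq_mul2l /= leq_pmull // npart_gt0.
Qed.

(** From j0 on, p(j+1)/p(j) is close to 1; the finitely many earlier terms and the new term a(w+1)
    are absorbed by [conv_npart_dominates]. *)
Lemma conv_npart_slow a : slow a -> {homo a : w w' / w <= w'} ->
  slow (conv_npart a).
Proof.
move=> slow_a mono_a J; pose L := 2 * J.
have [j0 j0P] := npart_slow L; pose c := npart j0.
have [w0 w0P] := conv_npart_dominates (L * (1 + c * j0)) slow_a mono_a.
exists w0 => w /w0P; set b := conv_npart a; set aw := a w.+1 => dom.
have tail : \sum_(j < w.+1) (j < j0) * a (w - j) <= j0 * aw.
  apply: leq_trans (_ : \sum_(j < w.+1) (j < j0) * aw <= _).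
    by apply: leq_sum => j _; rewrite leq_mul2l mono_a ?orbT //; lia.
  rewrite -big_distrl leq_mul2r /=; apply/orP; right.
  rewrite -(big_mkord predT (fun j => (j < j0) : nat)).
  case: (leqP j0 w.+1) => [le|/ltnW le]; first by rewrite sum_lt_index_iota ?subn0.
  apply: leq_trans (_ : \sum_(0 <= j < w.+1) 1 <= _).
    by apply: leq_sum => j _; case: (j < j0).
  by rewrite sum_nat_const_nat muln1 subn0.
have step : L * (\sum_(j < w.+1) npart j.+1 * a (w - j)) <=
    L.+1 * b w + L * c * (\sum_(j < w.+1) (j < j0) * a (w - j)).
  rewrite /b /conv_npart !big_distrr -big_split /= leq_sum // => j _.
  rewrite !mulnA -mulnDl leq_mul2r; apply/orP; right.
  case: (ltnP j j0) => [jj|/j0P h]; last by rewrite muln0 addn0.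
  by rewrite muln1 (leq_trans _ (leq_addl _ _)) // leq_mul2l npart_mono ?orbT.
have : L * b w.+1 <= L.+2 * b w.
  rewrite /b conv_npartS -/aw -/b; move: step tail dom.
  move: (\sum_(j < _) npart _ * _) (\sum_(j < _) (_ : bool) * _) (b w) aw.
  move=> S T x y h1 h2 h3; have := leq_mul (leqnn (L * c)) h2.
  by move: h1 h3; rewrite !mulnDr !mulnDl !mulnA muln1; lia.
by rewrite /L; nia.
Qed.

Lemma pt1 w : pt 1 w = npart w.
Proof.
rewrite /= big_ord_recr /= subnn muln1 big1 ?add0n // => j _.
by rewrite subn_eq0 leqNgt ltn_ord muln0.
Qed.

Lemma pt_mono t : 0 < t -> {homo pt t : w w' / w <= w'}.
Proof. by case: t => // t _; exact: conv_npart_mono. Qed.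

Lemma pt_slow t : 0 < t -> slow (pt t).
Proof.
case: t => // t _; elim: t => [|t IHt]; last exact: conv_npart_slow IHt (pt_mono _).
by move=> J; have [w0 w0P] := npart_slow J; exists w0 => w; rewrite !pt1; apply: w0P.
Qed.
Local Open Scope ring_scope.

(** * Sums over t-cores *)

(** The binomial coefficient c choose 2, for integers of either sign. *)
Definition bz (c : int) : int := (c * (c - 1) %/ 2)%Z.

Lemma bzE c : 2 * bz c = c * (c - 1).
Proof.
rewrite mulrC /bz divzK //; have /orP[] : (2 %| c)%Z || (2 %| c - 1)%Z by lia.
  exact: dvdz_mulr.
exact: dvdz_mull.
Qed.

Lemma bzD c d : bz (c + d) = bz c + bz d + c * d.
Proof. by have := bzE (c + d); have := bzE c; have := bzE d; nia. Qed.

Lemma bz_nat n : bz n%:Z = 'C(n, 2)%:Z.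
Proof.
have : (2 * 'C(n, 2) = n * n.-1)%N.
  case: n => [|n] //; rewrite bin2 mul2n halfK /= oddM /=.
  by case: (odd n); rewrite ?subn0.
by have := bzE n; case: n => [|n] /=; nia.
Qed.

Section CoreVectors.
Variable t : nat.
Implicit Types c : {ffun 'I_t -> int}.

(* The size of the t-core whose abacus has c i more beads on runner i than    *)
(* the empty partition.                                                       *)
Definition core_size c : int := \sum_(i < t) (t%:Z * bz (c i) + i%:Z * c i).

Definition core_ok (n : nat) c :=
  [&& \sum_i c i == 0, core_size c <= n%:Z & (t%:Z %| n%:Z - core_size c)%Z].
Definition quo_size (n : nat) c : nat := absz ((n%:Z - core_size c) %/ t%:Z)%Z.
Definition core_weight (n : nat) c : nat :=
  if core_ok n c then pt t (quo_size n c) else 0%N.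

Definition box (B : nat) : seq {ffun 'I_t -> int} :=
  [seq [ffun i => (d i : nat)%:Z - B%:Z] | d : {ffun 'I_t -> 'I_(2 * B).+1}].

(** For 0 <= i < t this convex quadratic is nonnegative at integers and grows at least linearly, so
    cores of bounded size lie in a bounded box. *)
Lemma core_term_bound (i : 'I_t) (c : int) : (1 < t)%N ->
  0 <= t%:Z * bz c + i%:Z * c /\ `|c| <= t%:Z * bz c + i%:Z * c + 1.
Proof.
move=> t_gt1; have := ltn_ord i; have := bzE c; move: (bz c) => b.
case: (leP 1 c) => hc bE i_lt.
  have hb : c - 1 <= b by nia.
  have : 0 <= i%:Z * c by nia.
  have : c - 1 <= t%:Z * b by nia.
  by split; lia.
have hb : - c <= b by nia.
have : t%:Z * (b + c) >= 0 by nia.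
have : (t%:Z - 1 - i%:Z) * (- c) >= 0 by nia.
by split; nia.
Qed.

Lemma core_size_bound c (i : 'I_t) : (1 < t)%N -> `|c i| <= core_size c + 1.
Proof.
move=> t_gt1; rewrite /core_size (bigD1 i) //=.
have := (core_term_bound i (c i) t_gt1).2.
move=> h; rewrite addrAC; apply: le_trans h _; rewrite lerDl.
by apply: sumr_ge0 => j _; have [] := core_term_bound j (c j) t_gt1.
Qed.

Lemma core_size_ge0 c : (1 < t)%N -> 0 <= core_size c.
Proof.
by move=> t_gt1; apply: sumr_ge0 => j _; have [] := core_term_bound j (c j) t_gt1.
Qed.

Lemma quo_sizeE n c : (1 < t)%N -> core_ok n c ->
  n%:Z = core_size c + t%:Z * (quo_size n c)%:Z.
Proof.
move=> t_gt1 /and3P[_ le_n dv]; rewrite /quo_size gez0_abs; last first.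
  by rewrite divz_ge0; lia.
by rewrite mulrC divzK //; lia.
Qed.

Lemma quo_size_le n c : (1 < t)%N -> core_ok n c -> (quo_size n c <= n)%N.
Proof.
by move=> t_gt1 ok; have := quo_sizeE t_gt1 ok; have := core_size_ge0 c t_gt1; nia.
Qed.

(** B beads pushed down on every runner form the empty partition, of weight bz(B t); this is the
    constant subtracted. *)
Lemma core_size_shift (B : nat) (d : {ffun 'I_t -> int}) :
  \sum_i d i = B%:Z * t%:Z ->
  \sum_(i < t) (t%:Z * bz (d i) + i%:Z * d i) - bz (B%:Z * t%:Z) =
  core_size [ffun i => d i - B%:Z].
Proof.
move=> sum_d; rewrite /core_size.
have -> : \sum_(i < t) (t%:Z * bz (d i) + i%:Z * d i) =
  \sum_(i < t) (t%:Z * bz (d i - B%:Z) + i%:Z * (d i - B%:Z)) +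
  \sum_(i < t) (t%:Z * (bz B%:Z + (d i - B%:Z) * B%:Z) + i%:Z * B%:Z).
  rewrite -big_split /=; apply: eq_bigr => i _.
  by have := bzD (d i - B%:Z) B%:Z; rewrite subrK => ->; ring.
have -> : \sum_(i < t) (t%:Z * bz ([ffun j => d j - B%:Z] i) + i%:Z * [ffun j => d j - B%:Z] i)
  = \sum_(i < t) (t%:Z * bz (d i - B%:Z) + i%:Z * (d i - B%:Z)).
  by apply: eq_bigr => i _; rewrite ffunE.
rewrite -[RHS]addr0 -addrA; congr (_ + _).
rewrite big_split /= -mulr_sumr -mulr_suml big_split /= sumr_const card_ord.
rewrite -mulr_suml sumrB sum_d sumr_const card_ord.
have -> : \sum_(i < t) i%:Z = bz t%:Z.
  by rewrite bz_nat -bin2_sum big_mkord -natz natr_sum; apply: eq_bigr => i _; rewrite natz.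
have mulrzt (x : int) : x *+ t = x * t%:Z by rewrite -mulr_natr natz.
rewrite !mulrzt; apply: (@mulfI _ (2 : int)) => //; rewrite mulr0.
transitivity (t%:Z * t%:Z * (2 * bz B%:Z) + 2 * bz t%:Z * B%:Z - 2 * bz (B%:Z * t%:Z)).
  by ring.
by rewrite !bzE; ring.
Qed.

End CoreVectors.

Lemma mem_box t B (c : {ffun 'I_t -> int}) :
  (c \in box t B) = [forall i, `|c i| <= B%:Z].
Proof.
apply/mapP/forallP => [[d _ ->] i|h].
  by rewrite ffunE; have := ltn_ord (d i); move: (d i : nat) => x; lia.
exists [ffun i => inord (absz (c i + B%:Z))]; first by rewrite mem_enum.
apply/ffunP => i; rewrite !ffunE; have := h i; move: (c i) => x hx.
have x_ge0 : 0 <= x + B%:Z by lia.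
by rewrite inordK ?gez0_abs ?addrK // -ltz_nat gez0_abs //; lia.
Qed.

Lemma box_uniq t B : uniq (box t B).
Proof.
rewrite map_inj_uniq ?enum_uniq // => d d' /ffunP eq_d; apply/ffunP => i.
by have := eq_d i; rewrite !ffunE => /addIr [] /val_inj.
Qed.

Lemma size_box t B : size (box t B) = ((2 * B).+1 ^ t)%N.
Proof. by rewrite size_map -cardE card_ffun !card_ord. Qed.

Lemma core_ok_mem_box t n B (c : {ffun 'I_t -> int}) : (1 < t)%N ->
  (n < B)%N -> core_ok n c -> c \in box t B.
Proof.
move=> t_gt1 nB /and3P[_ le_n _]; rewrite mem_box; apply/forallP => i.
by have := core_size_bound c i t_gt1; lia.
Qed.

(** The core-quotient correspondence in summed form: the bead numbers of the runners determine the
    core, the bead positions the quotient. *)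
Theorem sum_t_hooks_cores (V : zmodType) t n (g : nat -> V) : (1 < t)%N ->
  \sum_(la : partition_of n) g (size (t_hooks t la)) =
  \sum_(c <- box t (2 * n).+1) g (quo_size n c) *+ core_weight n c.
Proof.
(* A contributing core has |c i| <= n+1 and a quotient size w <= n. With d i = c i + B beads on
   runner i this gives w <= n <= d i and w + d i <= 4n+2 = K, as [card_families] demands. *)
move=> t_gt1; set B := (2 * n).+1; pose K := (2 * B)%N.
rewrite (@sum_t_hooks (B * t) (K * t) n); [|nia|nia].
rewrite big_map big_enum /= -/K.
pose C (F : {ffun 'I_t -> {set 'I_K}}) :=
  (\sum_i #|F i| == B * t)%N &&
  (\sum_(i < t) (t * wt (F i) + i * #|F i|) == n + 'C(B * t, 2))%N.
transitivity (\sum_(F : {ffun 'I_t -> {set 'I_K}} | C F) g (\sum_i tinv 1 (F i))).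
  rewrite [RHS](reindex _ (onW_bij _ (@split_set_bij t K))) /=.
  by apply: eq_big => [X|X _]; rewrite ?tinv_split // /C -card_split -wt_split.
pose dim (F : {ffun 'I_t -> {set 'I_K}}) : {ffun 'I_t -> 'I_K.+1} :=
  [ffun i => inord #|F i|].
have dimE F i : dim F i = #|F i| :> nat.
  by rewrite ffunE inordK // ltnS (leq_trans (max_card _)) ?card_ord.
rewrite (partition_big dim predT) //=; apply: eq_bigr => d _.
set c := [ffun i => _].
have sum_c : \sum_i c i = (\sum_i (d i : nat))%N%:Z - B%:Z * t%:Z.
  rewrite -natz natr_sum (eq_bigr (fun i => (d i : nat)%:Z - B%:Z)) => [|i _]; last by rewrite ffunE.
  rewrite sumrB sumr_const card_ord -mulr_natr natz; congr (_ - _).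
  by apply: eq_bigr => i _; rewrite natz.
(* For fixed bead numbers, the weight condition prescribes exactly the size of the quotient. *)
have condE F : (C F && (dim F == d)) =
    core_ok n c && [forall i, #|F i| == d i] && (\sum_i tinv 1 (F i) == quo_size n c)%N.
  have -> : (dim F == d) = [forall i, #|F i| == d i].
    apply/eqP/forallP => [<- i|h]; first by rewrite dimE.
    by apply/ffunP => i; apply: val_inj; rewrite /= dimE (eqP (h i)).
  rewrite andbAC; case: forallP => [h|]; rewrite ?andbF ?andbT //.
  have cF i : #|F i| = d i by apply/eqP.
  rewrite /C (eq_bigr (fun i => d i : nat)) => [|i _]; last exact: cF.
  case: (eqVneq (\sum_i (d i : nat))%N (B * t)%N) => [sum_d|sum_d] /=; last first.
    rewrite /core_ok sum_c; case: eqP => //= eq0; case/eqP: sum_d.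
    by move: (\sum_i _)%N eq0 => x; lia.
  have sum_dz : \sum_i [ffun i => (d i : nat)%:Z] i = B%:Z * t%:Z.
    rewrite -PoszM -sum_d -natz natr_sum; apply: eq_bigr => i _; by rewrite ffunE natz.
  have eq_cs := core_size_shift sum_dz.
  have eq_c : [ffun i => [ffun i => (d i : nat)%:Z] i - B%:Z] = c.
    by apply/ffunP => i; rewrite !ffunE.
  rewrite eq_c -PoszM bz_nat in eq_cs.
  have eqW : (\sum_(i < t) (t * wt (F i) + i * #|F i|))%N%:Z =
     t%:Z * (\sum_i tinv 1 (F i))%N%:Z + core_size c + 'C(B * t, 2)%:Z.
    rewrite -eq_cs -addrA subrK -!natz !natr_sum mulr_sumr -big_split /=.
    apply: eq_bigr => i _; rewrite !ffunE !natz bz_nat -tinv1_wt cF.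
    by rewrite !PoszD !PoszM PoszD; ring.
  have sum_c0 : \sum_i c i = 0 by rewrite sum_c sum_d PoszM subrr.
  move: eqW; set S1 := (\sum_(i < t) _)%N; set S2 := (\sum_(i < t) _)%N => eqW.
  apply/eqP/andP => [eqS|[ok /eqP eqS]]; last first.
    by have := quo_sizeE t_gt1 ok; rewrite -eqS; lia.
  have nE : n%:Z - core_size c = t%:Z * S2%:Z by lia.
  rewrite /core_ok /quo_size sum_c0 nE dvdz_mulr // mulKz; last by lia.
  by split=> //; rewrite eqxx andbT /=; nia.
rewrite (eq_bigl _ _ condE) /core_weight; case: ifPn => [ok|nok]; last first.
  by rewrite big_pred0 // => F; rewrite (negbTE nok).
rewrite -(@card_families t K _ (fun i => d i : nat)); last 2 first.
- move=> i; have := quo_size_le t_gt1 ok.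
  by have := core_ok_mem_box t_gt1 (ltnSn n) ok; rewrite mem_box => /forallP/(_ i); rewrite ffunE; lia.
- have KE : K = (4 * n + 2)%N by rewrite /K /B; lia.
  move=> i; have := quo_size_le t_gt1 ok; have := core_ok_mem_box t_gt1 (ltnSn n) ok.
  rewrite mem_box => /forallP/(_ i); rewrite ffunE; move: (d i : nat) (quo_size n c).
  by move=> x q; rewrite KE /B; lia.
rewrite -sumr_const; apply: eq_big => [F|F]; first by rewrite inE.
by move=> /andP[_ /eqP->].
Qed.

(** * Alternating sums along a direction of the core lattice *)

Lemma eq_big_support (T : eqType) (V : zmodType) (s s' : seq T) (F : T -> V) :
  uniq s -> uniq s' -> (forall x, F x != 0 -> x \in s) ->
  (forall x, F x != 0 -> x \in s') -> \sum_(x <- s) F x = \sum_(x <- s') F x.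
Proof.
move=> uniq_s uniq_s' ss ss'.
have filt r : \sum_(x <- r) F x = \sum_(x <- [seq x <- r | F x != 0]) F x.
  rewrite big_filter (bigID (fun x => F x != 0)) /= [X in _ + X]big1 ?addr0 // => x.
  by rewrite negbK => /eqP.
rewrite filt [RHS]filt; apply: perm_big; apply: uniq_perm; rewrite ?filter_uniq //.
by move=> x; rewrite !mem_filter; case: eqVneq => //= /[dup] /ss -> /ss' ->.
Qed.

Section Alternating.
Variables (R : realType) (t : nat).
Hypothesis t_gt1 : (1 < t)%N.
Implicit Types c u : {ffun 'I_t -> int}.

(** A smaller core leaves a larger quotient, and [pt] is monotone. *)
Lemma core_weight_le n c c' : \sum_k c k = \sum_k c' k ->
  core_size c <= core_size c' -> (t%:Z %| core_size c' - core_size c)%Z ->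
  (core_weight n c' <= core_weight n c)%N.
Proof.
move=> eq_sum le_cc' dv; rewrite {1}/core_weight; case: ifPn => // ok'.
have ok : core_ok n c.
  move: ok'; rewrite /core_ok eq_sum => /and3P[-> le_n dv'].
  rewrite (le_trans le_cc' le_n) /=.
  have -> : n%:Z - core_size c = core_size c' - core_size c + (n%:Z - core_size c') by ring.
  exact: rpredD.
rewrite /core_weight ok.
have := quo_sizeE t_gt1 ok; have := quo_sizeE t_gt1 ok'.
by move=> e1 e2; apply: (pt_mono (ltnW t_gt1)); nia.
Qed.

Lemma core_weight_ok n c : (core_weight n c)%:R != 0 :> R -> core_ok n c.
Proof. by rewrite /core_weight; case: ifP => // _; rewrite eqxx. Qed.

(* Summing over a larger box changes nothing, since core_ok n confines c to   *)
(* the box of radius n + 1.                                                   *)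
Definition csum n (F : {ffun 'I_t -> int} -> R) :=
  \sum_(c <- box t n.+1) F c * (core_weight n c)%:R.

Lemma csum_shift n (F : {ffun 'I_t -> int} -> R) u (b B : nat) :
  (forall k, `|u k| <= b%:Z) -> (n + b < B)%N ->
  \sum_(c <- box t B) F (c + u) * (core_weight n (c + u))%:R = csum n F.
Proof.
move=> u_le lt_B; rewrite /csum -(big_map (fun c => c + u) predT (fun c => F c * (core_weight n c)%:R)).
apply: eq_big_support; rewrite ?box_uniq //.
- by rewrite map_inj_uniq ?box_uniq //; exact: addIr.
- move=> c; rewrite mulf_eq0 negb_or => /andP[_ /core_weight_ok ok].
  apply/mapP; exists (c - u); rewrite ?subrK // mem_box.
  have := core_ok_mem_box t_gt1 (ltnSn n) ok; rewrite mem_box => /forallP c_le.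
  apply/forallP => k; have := c_le k; have := u_le k; rewrite !ffunE.
  by move: (c k) (u k) => x y; lia.
- by move=> c; rewrite mulf_eq0 negb_or => /andP[_ /core_weight_ok]; apply: core_ok_mem_box.
Qed.

Lemma csum_box n (F : {ffun 'I_t -> int} -> R) (B : nat) : (n < B)%N ->
  \sum_(c <- box t B) F c * (core_weight n c)%:R = csum n F.
Proof.
move=> lt_B; rewrite -(@csum_shift n F 0 0 B) ?addn0 //.
  by apply: eq_bigr => c _; rewrite addr0.
by move=> k; rewrite ffunE normr0.
Qed.

Lemma csum_hooks n (g : nat -> R) :
  \sum_(la : partition_of n) g (size (t_hooks t la)) =
  csum n (fun c => g (quo_size n c)).
Proof.
rewrite sum_t_hooks_cores // -(@csum_box _ _ (2 * n).+1); last by lia.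
by apply: eq_bigr => c _; rewrite mulr_natr.
Qed.

Lemma csum_npart n : csum n (fun=> 1) = (npart n)%:R.
Proof. by rewrite -(csum_hooks n (fun=> 1)) sumr_const. Qed.

Lemma ler_csum n F G : (forall c, core_ok n c -> F c <= G c) -> csum n F <= csum n G.
Proof.
move=> le_FG; apply: ler_sum => c _.
case ok : (core_ok n c); last by rewrite /core_weight ok !mulr0.
by rewrite ler_wpM2r // le_FG.
Qed.

Lemma eq_csum n F G : (forall c, core_ok n c -> F c = G c) -> csum n F = csum n G.
Proof. by move=> eq_FG; apply/eqP; rewrite eq_le !ler_csum // => c /eq_FG->. Qed.

Lemma csumD n F G : csum n (fun c => F c + G c) = csum n F + csum n G.
Proof. by rewrite /csum -big_split; apply: eq_bigr => c _; rewrite mulrDl. Qed.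

Lemma csumZ n x F : csum n (fun c => x * F c) = x * csum n F.
Proof. by rewrite /csum mulr_sumr; apply: eq_bigr => c _; rewrite mulrA. Qed.

(** * Lines in direction t(e_i - e_j) and their peaks *)

Section Direction.
Variables i j : 'I_t.
Hypothesis neq_ij : i != j.

(** The factor t makes [core_size] change by a multiple of t, so the residue condition in [core_ok]
    is preserved. *)
Definition dir : {ffun 'I_t -> int} :=
  [ffun k => ((k == i)%:Z - (k == j)%:Z) * t%:Z].
(* The increment of core_size along dir, divided by t. *)
Definition slope c : int := t%:Z * (c i - c j) + t%:Z ^+ 2 + i%:Z - j%:Z.

Lemma dir_i : dir i = t%:Z.
Proof. by rewrite ffunE eqxx (negbTE neq_ij) subr0 mul1r. Qed.

Lemma dir_j : dir j = - t%:Z.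
Proof. by rewrite ffunE eqxx eq_sym (negbTE neq_ij) sub0r mulN1r. Qed.

Lemma dir_other k : k != i -> k != j -> dir k = 0.
Proof. by move=> /negbTE ki /negbTE kj; rewrite ffunE ki kj mul0r. Qed.

Lemma dir_le k : `|dir k| <= t%:Z.
Proof. by rewrite ffunE; case: (k == i); case: (k == j); lia. Qed.

Lemma dirMn_le m k : `|(dir *+ m) k| <= (m * t)%N%:Z.
Proof.
rewrite ffunMnE normrMn -mulr_natl natz PoszM ler_wpM2l //; exact: dir_le.
Qed.

Lemma sum_dir c : \sum_k (c + dir) k = \sum_k c k.
Proof.
under eq_bigr do rewrite ffunE; rewrite big_split /= [X in _ + X](_ : _ = 0) ?addr0 //.
rewrite (bigD1 i) //= (bigD1 j) 1?eq_sym //= big1 => [|k /andP[ki kj]].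
  by rewrite dir_i dir_j addr0 subrr.
exact: dir_other.
Qed.

Lemma core_size_dir c : core_size (c + dir) = core_size c + t%:Z * slope c.
Proof.
rewrite /core_size; under eq_bigr do rewrite ffunE bzD.
have -> : \sum_(k < t) (t%:Z * (bz (c k) + bz (dir k) + c k * dir k) + k%:Z * (c k + dir k)) =
  \sum_(k < t) (t%:Z * bz (c k) + k%:Z * c k) +
  \sum_(k < t) (t%:Z * (bz (dir k) + c k * dir k) + k%:Z * dir k).
  by rewrite -big_split; apply: eq_bigr => k _ /=; ring.
congr (_ + _).
rewrite (bigD1 i) //= (bigD1 j) 1?eq_sym //= big1 => [|k /andP[ki kj]].
  rewrite dir_i dir_j /slope addr0.
  have := bzE t%:Z; have := bzE (- t%:Z); move: (bz _) (bz _) => a b ha hb.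
  have -> : a = t%:Z ^+ 2 - b by lia.
  by ring.
by rewrite dir_other // (_ : bz 0 = 0) //; ring.
Qed.

Lemma slope_dir c : slope (c + dir) = slope c + 2 * t%:Z ^+ 2.
Proof.
by rewrite /slope ![(c + dir) _]ffunE dir_i dir_j; ring.
Qed.

Lemma slope_dirMn c m : slope (c + dir *+ m) = slope c + 2 * t%:Z ^+ 2 * m%:Z.
Proof.
elim: m => [|m IHm]; first by rewrite mulr0n addr0 mulr0 addr0.
by rewrite mulrSr addrA slope_dir IHm intS; ring.
Qed.

Lemma sum_dirMn c m : \sum_k (c + dir *+ m) k = \sum_k c k.
Proof.
by elim: m => [|m IHm]; rewrite ?mulr0n ?addr0 // mulrSr addrA sum_dir.
Qed.

Lemma core_size_dirMn c m : core_size (c + dir *+ m) =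
  core_size c + t%:Z * (m%:Z * slope c + t%:Z ^+ 2 * (m%:Z * (m%:Z - 1))).
Proof.
elim: m => [|m IHm]; first by rewrite mulr0n addr0 !mul0r mulr0 addr0 mulr0 addr0.
by rewrite mulrSr addrA core_size_dir IHm slope_dirMn intS; ring.
Qed.

(** Since [slope] grows by 2t^2 per step, this marks one point on each line, where [core_size] is
    least and the weight largest. *)
Definition peak c : R := ((0 <= slope c) && (slope c < 2 * t%:Z ^+ 2))%:R.

(* Along dir the weights are unimodal, so their alternating sum is at most    *)
(* the total variation, i.e. the sum of the weights at the peaks.             *)
Lemma alternating_le_peak n h : (forall c, h (c + dir) = - h c) ->
  (forall c, `|h c| <= 1) -> `|csum n h| <= csum n peak.
Proof.
move=> h_alt h_le; pose eps c : R := if 0 <= slope c then 1 else -1.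
pose B := (n + t).+1; pose W c : R := (core_weight n c)%:R.
have lt_B : (n + t < B)%N by [].
have lt_nB : (n < B)%N by rewrite /B; lia.
(* Summation by parts: alternation pairs each c with c + dir. *)
have E1 : csum n h *+ 2 = \sum_(c <- box t B) h c * (W c - W (c + dir)).
  rewrite mulr2n -{1}(csum_box h lt_nB) -(csum_shift h dir_le lt_B) -big_split /=.
  by apply: eq_bigr => c _; rewrite h_alt /W; ring.
(* [peak] is half the increment of [eps] along [dir]. As [eps] is the sign of W c - W (c + dir)
   wherever that is nonzero, the right side is the total variation. *)
have E2 : csum n peak *+ 2 = \sum_(c <- box t B) eps c * (W c - W (c + dir)).
  transitivity (csum n eps - csum n (fun c => eps (c - dir))).
    rewrite -mulr_natl -csumZ -[- _]mulN1r -csumZ -csumD; apply: eq_csum => c _.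
    have := slope_dir (c - dir); rewrite subrK => sE.
    rewrite /peak /eps sE; move: (slope _) => x; have t2 : 0 < t%:Z ^+ 2 by nia.
    move: (t%:Z ^+ 2) t2 => y y_gt0.
    case: (leP 0 x) => hx.
      have -> : 0 <= x + 2 * y by lia.
      have -> : (x + 2 * y < 2 * y) = false by lia.
      by rewrite andbF mulr0 mulN1r subrr.
    have -> : x + 2 * y < 2 * y by lia.
    rewrite andbT; case: ifP => _; first by rewrite mulN1r opprK mulr1.
    by rewrite mulr0 mulN1r opprK addNr.
  rewrite -(csum_box eps lt_nB) -(csum_shift _ dir_le lt_B) -mulN1r mulr_sumr -big_split /=.
  by apply: eq_bigr => c _; rewrite addrK /W; ring.
rewrite -(ler_pMn2r (isT : (0 < 2)%N)) -normrMn E1 E2.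
apply: le_trans (ler_norm_sum _ _ _) _; apply: ler_sum => c _; rewrite normrM.
apply: le_trans (ler_wpM2r (normr_ge0 _) (h_le c)) _; rewrite mul1r /eps.
have := core_size_dir c; have := sum_dir c; case: ifPn => s_c sumE sizeE.
  rewrite mul1r ger0_norm // subr_ge0 ler_nat; apply: core_weight_le => //.
    by rewrite sizeE lerDl mulr_ge0.
  by rewrite sizeE addrAC subrr add0r dvdz_mulr.
rewrite -ltNge in s_c; rewrite mulN1r ler0_norm // subr_le0 ler_nat.
apply: core_weight_le => //; first by rewrite sizeE gerDl; nia.
by rewrite sizeE opprD addNKr -mulrN dvdz_mulr.
Qed.

(** Translates of [peak] by different multiples of [dir] have disjoint supports; in the proof their
    sum telescopes to a value at most 1. *)
Lemma sum_peak_le n J : \sum_(k < J) csum n (fun c => peak (c - dir *+ k)) <= (npart n)%:R.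
Proof.
rewrite -csum_npart /csum exchange_big /=; apply: ler_sum => c _.
rewrite -mulr_suml; apply: ler_wpM2r => //.
pose f (k : nat) : R := ((2 * t%:Z ^+ 2 * k%:Z <= slope c)%R)%:R.
rewrite (eq_bigr (fun k : 'I_J => f k - f k.+1)) => [|k _]; last first.
  have := slope_dirMn (c - dir *+ k) k; rewrite subrK => sE; rewrite /peak /f sE.
  move: (slope _) => x; rewrite intS mulrDr mulr1.
  have t2 : 0 <= 2 * t%:Z ^+ 2 by nia.
  move: (2 * t%:Z ^+ 2) t2 => y y_ge0; rewrite lerDr lerD2r.
  case: (leP 0 x) => hx /=; case: (leP y x) => hy /=; rewrite ?subr0 ?subrr //; lia.
rewrite -(big_mkord predT (fun k => f k - f k.+1)) -[X in X <= _]opprK -sumrN.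
under eq_bigr do rewrite opprB.
rewrite telescope_sumr // opprB.
have f01 k : 0 <= f k <= 1 by rewrite /f ler0n lern1 leq_b1.
by have := f01 0%N; have := f01 J; lra.
Qed.

(* From a peak, J steps along dir reduce the quotient size by a bounded       *)
(* amount, so their weights are comparable to the weight of the peak.         *)
Lemma csum_peak_small J : exists n0, forall n, (n0 <= n)%N ->
  J%:R * csum n peak <= 3 * (npart n)%:R.
Proof.
(* Bounds the loss of quotient size in at most J steps from a peak, where the slope is below
   2t^2. *)
pose m := (t ^ 2 * (2 * J + J * J))%N.
have [w0 w0P] : exists w0, forall w k, (w0 <= w)%N -> (k <= m)%N ->
    (pt t w <= 2 * pt t (w - k))%N.
  exact: slow_half (pt_slow (ltnW t_gt1)) (pt_mono (ltnW t_gt1)).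
pose w1 := (w0 + m)%N.
(* Cores with quotient below [w1] weigh at most pt(w1) (2n+3)^t in total; 2n+3 <= 3(n+1) explains
   3^t. *)
have [n0 n0P] := npart_gt_poly (J * (pt t w1 * 3 ^ t)) t.
exists n0 => n /n0P small.
pose big c := (w1 <= quo_size n c)%N.
have few : csum n (fun c => (~~ big c)%:R) <= (pt t w1 * (2 * n + 3) ^ t)%N%:R.
  apply: le_trans (_ : \sum_(c <- box t n.+1) (pt t w1)%:R <= _).
    apply: ler_sum => c _; rewrite /big; case: leqP => [_|lt_w]; first by rewrite mul0r.
    rewrite mul1r ler_nat /core_weight; case: ifP => // _.
    exact: (pt_mono (ltnW t_gt1)) (ltnW lt_w).
  rewrite big_const_seq count_predT size_box iter_addr_0 -mulrnA ler_nat leq_mul2l.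
  by rewrite (_ : (2 * n.+1).+1 = (2 * n + 3)%N) ?leqnn ?orbT //; lia.
have step (k : 'I_J) : csum n peak <=
   2 * csum n (fun c => peak (c - dir *+ k)) + csum n (fun c => (~~ big c)%:R).
  pose B := (n + k * t).+1.
  have lt_B : (n + k * t < B)%N by [].
  have lt_nB : (n < B)%N by rewrite /B; lia.
  rewrite -(csum_shift (fun c => peak (c - dir *+ k)) (dirMn_le k) lt_B) mulr_sumr.
  rewrite -(csum_box (fun c => (~~ big c)%:R) lt_nB) -(csum_box peak lt_nB) -big_split /=.
  apply: ler_sum => c _; rewrite addrK /peak.
  case: (boolP (_ && _)) => [/andP[s_ge0 s_lt]|_]; last first.
    by rewrite !mul0r mulr0 add0r mulr_ge0.
  rewrite !mul1r; case: (boolP (big c)) => [big_c|_]; last first.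
    by rewrite mul1r lerDr mulr_ge0.
  rewrite mul0r addr0 -natrM ler_nat {1}/core_weight; case: ifPn => // ok.
  have k_le : (k <= J)%N by rewrite ltnW.
  pose dr := k%:Z * slope c + t%:Z ^+ 2 * (k%:Z * (k%:Z - 1)).
  have sizeE : core_size (c + dir *+ k) = core_size c + t%:Z * dr := core_size_dirMn c k.
  have dr_ge0 : 0 <= dr by rewrite /dr; case: (nat_of_ord k) => [|k']; nia.
  have dr_le : dr <= m%:Z.
    have : k%:Z * slope c <= J%:Z * (2 * t%:Z ^+ 2) by apply: ler_pM => //; lia.
    have : t%:Z ^+ 2 * (k%:Z * (k%:Z - 1)) <= t%:Z ^+ 2 * (J%:Z * J%:Z).
      by rewrite ler_wpM2l ?sqr_ge0 //; nia.
    have mE : m%:Z = t%:Z ^+ 2 * (2 * J%:Z + J%:Z * J%:Z).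
      by rewrite /m -mulnn expr2 !(PoszM, PoszD).
    by rewrite /dr mE; nia.
  have quoE := quo_sizeE t_gt1 ok.
  have drE : dr = (absz dr)%:Z by rewrite gez0_abs.
  have ok' : core_ok n (c + dir *+ k).
    move: ok; rewrite /core_ok sum_dirMn sizeE => /and3P[-> _ _] /=.
    rewrite quoE; apply/andP; split; last first.
      by rewrite opprD addrACA subrr add0r -mulrBr dvdz_mulr.
    rewrite lerD2l ler_wpM2l //; move: big_c; rewrite /big /w1; lia.
  rewrite /core_weight ok'.
  have -> : quo_size n (c + dir *+ k) = (quo_size n c - absz dr)%N.
    have := quo_sizeE t_gt1 ok'; rewrite sizeE {1}quoE -addrA => /addrI.
    by rewrite -mulrDr => /mulfI qE; have := qE ltac:(lia); lia.
  by apply: w0P; [move: big_c; rewrite /big /w1; lia|lia].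
have : \sum_(k < J) csum n peak <= \sum_(k < J)
   (2 * csum n (fun c => peak (c - dir *+ k)) + csum n (fun c => (~~ big c)%:R)).
  by apply: ler_sum => k _; apply: step.
rewrite sumr_const card_ord big_split /= -mulr_sumr sumr_const card_ord.
rewrite -(mulr_natl (csum n peak)) -(mulr_natl (csum n (fun c => (~~ big c)%:R))).
move=> le1; apply: le_trans le1 _.
have -> : 3 * (npart n)%:R = 2 * (npart n)%:R + (npart n)%:R :> R by ring.
apply: lerD; first by rewrite ler_wpM2l // sum_peak_le.
apply: le_trans (ler_wpM2l _ few) _; first exact: ler0n.
rewrite -natrM ler_nat; apply: leq_trans small.
rewrite -!mulnA leq_mul2l leq_mul2l -expnMn leq_exp2r ?orbT ?(ltnW t_gt1) //; last lia.
Qed.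

(** The threshold is uniform in [h], so [h] may depend on n. *)
Lemma alternating_small J : exists n0, forall n (h : {ffun 'I_t -> int} -> R),
  (n0 <= n)%N -> (forall c, h (c + dir) = - h c) -> (forall c, `|h c| <= 1) ->
  J%:R * `|csum n h| <= 3 * (npart n)%:R.
Proof.
have [n0 n0P] := csum_peak_small J; exists n0 => n h /n0P le3 h_alt h_le.
by apply: le_trans le3; rewrite ler_wpM2l // alternating_le_peak.
Qed.

End Direction.
End Alternating.

(** * Sign averages *)

Definition negligible (R : realType) t (h : nat -> {ffun 'I_t -> int} -> R) :=
  (csum n (h n) / (npart n)%:R @[n --> \oo] --> (0 : R))%classic.

Section Negligible.
Variables (R : realType) (t : nat).
Hypothesis t_gt1 : (1 < t)%N.
Implicit Types h : nat -> {ffun 'I_t -> int} -> R.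

Let p_gt0 n : 0 < (npart n)%:R :> R. Proof. by rewrite ltr0n npart_gt0. Qed.

Lemma negligible_alternating h (i j : 'I_t) : i != j ->
  (forall n c, h n (c + dir i j) = - h n c) -> (forall n c, `|h n c| <= 1) ->
  negligible h.
Proof.
move=> neq_ij h_alt h_le; apply/cvgr0Pnorm_le => e e_gt0.
have e3 : 0 <= 3 / e by rewrite divr_ge0 // ltW.
have := archi_boundP e3.
set J := Num.bound _; rewrite ltr_pdivrMr // => lt3.
have [n0 n0P] := alternating_small R t_gt1 neq_ij J.
exists n0 => // n /= n_ge.
have := n0P n (h n) n_ge (h_alt n) (h_le n).
rewrite normrM normfV [X in _ / X]gtr0_norm // ler_pdivrMr // => le3.
have J_gt0 : 0 < J%:R :> R by rewrite -(pmulr_lgt0 _ e_gt0) (lt_trans _ lt3).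
rewrite -(ler_pM2l J_gt0) (le_trans le3) // mulrA ler_wpM2r // ltW //.
Qed.

Lemma negligibleD h h' : negligible h -> negligible h' ->
  negligible (fun n c => h n c + h' n c).
Proof.
move=> nh nh'; have lim := cvgD nh nh'; rewrite addr0 in lim.
rewrite /negligible (_ : (fun n => _) =
  (fun n => csum n (h n) / (npart n)%:R) \+ (fun n => csum n (h' n) / (npart n)%:R)); first exact: lim.
by apply/funext => n /=; rewrite csumD mulrDl.
Qed.

Lemma negligibleZ x h : negligible h -> negligible (fun n c => x * h n c).
Proof.
move=> nh; have lim := cvgM (cvg_cst x) nh; rewrite mulr0 in lim.
rewrite /negligible (_ : (fun n => _) =
  (fun=> x) \* (fun n => csum n (h n) / (npart n)%:R)); first exact: lim.
by apply/funext => n /=; rewrite csumZ mulrA.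
Qed.

Lemma eq_negligible h h' : (forall n c, core_ok n c -> h n c = h' n c) ->
  negligible h -> negligible h'.
Proof.
move=> eq_h; rewrite /negligible.
by under eq_fun do rewrite (eq_csum (eq_h _)).
Qed.

Lemma negligible0 : negligible (fun _ (_ : {ffun 'I_t -> int}) => 0 : R).
Proof.
rewrite /negligible (_ : (fun n => _) = fun=> 0); first exact: cvg_cst.
by apply/funext => n; rewrite /csum big1 ?mul0r // => c _; rewrite mul0r.
Qed.

End Negligible.

Section Signs.
Variable R : realType.

Definition sg (z : int) : R := if (2 %| z)%Z then 1 else -1.

Lemma sgD x y : sg (x + y) = sg x * sg y.
Proof.
rewrite /sg; case: ifP; case: ifP; case: ifP => h1 h2 h3; rewrite ?mulr1 ?mul1r ?mulrNN ?mulr1 //; lia.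
Qed.

Lemma norm_sg x : `|sg x| = 1.
Proof. by rewrite /sg; case: ifP; rewrite ?normrN normr1. Qed.

Lemma sg_odd x : ~~ (2 %| x)%Z -> sg x = -1.
Proof. by rewrite /sg => /negbTE->. Qed.

Lemma sg_nat n : sg n%:Z = (-1) ^+ n.
Proof. by rewrite -signr_odd /sg dvdzE /= dvdn2; case: (odd n). Qed.

End Signs.

(** * Even t: the sign alternates in one direction *)

Section EvenModulus.
Variables (R : realType) (t : nat).
Hypotheses (t_gt1 : (1 < t)%N) (t_even : ~~ odd t).

Lemma negligible_even_modulus :
  negligible (fun n (c : {ffun 'I_t -> int}) => (-1) ^+ quo_size n c : R).
Proof.
pose i0 : 'I_t := Ordinal (ltnW t_gt1); pose i1 : 'I_t := Ordinal t_gt1.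
have neq_10 : i1 != i0 by [].
apply: (@eq_negligible R t (fun n c => sg R ((n%:Z - core_size c) %/ t%:Z)%Z)).
  move=> n c ok; rewrite -sg_nat; congr sg.
  by rewrite (quo_sizeE t_gt1 ok) addrAC subrr add0r mulKz //; lia.
apply: (negligible_alternating t_gt1 neq_10) => n c; last by rewrite norm_sg.
rewrite (core_size_dir t_gt1 neq_10).
have -> : n%:Z - (core_size c + t%:Z * slope i1 i0 c) =
  - slope i1 i0 c * t%:Z + (n%:Z - core_size c) by ring.
rewrite divzMDl; last by lia.
(* For even t the slope from runner 0 to runner 1 is congruent to 1 - 0 modulo 2, hence odd. *)
rewrite sgD sg_odd ?mulN1r // /slope /= expr2.
have /dvdzP[q ->] : (2 %| t%:Z)%Z by lia.
by move: (c i1 - c i0) => x; rewrite -!mulrA; lia.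
Qed.

End EvenModulus.

(** * Odd t: runners in k pairs with one left over *)

Lemma sum_pairs (k : nat) (g : nat -> int) :
  \sum_(0 <= a < k.*2.+1) g a =
  \sum_(0 <= l < k) (g l.*2 + g l.*2.+1) + g k.*2.
Proof.
elim: k => [|k IHk]; first by rewrite big_nat1 big_geq // add0r.
by rewrite doubleS big_nat_recr //= big_nat_recr //= IHk [in RHS]big_nat_recr //=; ring.
Qed.

Section OddModulus.
Variables (R : realType) (k : nat).
Hypothesis k_gt0 : (0 < k)%N.
Let t := k.*2.+1.
Implicit Types c : {ffun 'I_t -> int}.

Let t_gt1 : (1 < t)%N. Proof. by rewrite /t; lia. Qed.

Definition bead c (a : nat) : int := c (inord a).

Definition matched l c : R := ((2 %| bead c l.*2 - bead c l.*2.+1)%Z)%:R.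
Definition all_matched l c : R := \prod_(0 <= a < l) matched a c.

Lemma sum_bead (G : nat -> int -> int) c :
  \sum_(i < t) G i (c i) = \sum_(0 <= a < t) G a (bead c a).
Proof.
rewrite big_mkord; apply: eq_bigr => i _.
by rewrite /bead inord_val.
Qed.

(** Modulo 2 the terms reduce to bz a + bz b + b; with a = b + 2s, bz a is bz b + s, so s + b =
    (a+b)/2 remains. *)
Lemma pair_parity (l : nat) (a b : int) : (2 %| a - b)%Z ->
  (2 %| t%:Z * bz a + l.*2%:Z * a + (t%:Z * bz b + l.*2.+1%:Z * b)
        - ((a + b) %/ 2)%Z)%Z.
Proof.
move=> /dvdzP[s abE]; have -> : a = s * 2 + b by rewrite -abE subrK.
have -> : ((s * 2 + b + b) %/ 2)%Z = s + b by lia.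
have bz2 : bz (s * 2) = s * (s * 2 - 1) by have := bzE (s * 2); lia.
rewrite bzD bz2; apply/dvdzP.
exists (k%:Z * (2 * bz b + s * (s * 2 - 1) + s * 2 * b) +
   bz b + s * s - s + s * b + 2 * l%:Z * b + 2 * l%:Z * s).
have -> : t%:Z = 2 * k%:Z + 1 by rewrite /t; lia.
have -> : l.*2.+1%:Z = 2 * l%:Z + 1 by lia.
have -> : l.*2%:Z = 2 * l%:Z by lia.
by ring.
Qed.

(* A matched pair contributes half its bead sum modulo 2, and the last runner *)
(* cancels the total because the beads sum to 0.                              *)
Lemma core_size_parity c : \sum_i c i = 0 ->
  (forall l, (l < k)%N -> (2 %| bead c l.*2 - bead c l.*2.+1)%Z) ->
  (2 %| core_size c)%Z.
Proof.
move=> sum0 match_c.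
rewrite /core_size (sum_bead (fun a x => t%:Z * bz x + a%:Z * x)) sum_pairs.
move: sum0; rewrite (sum_bead (fun _ x => x)) sum_pairs.
pose s l := ((bead c l.*2 + bead c l.*2.+1) %/ 2)%Z.
have -> : \sum_(0 <= l < k) (bead c l.*2 + bead c l.*2.+1) = 2 * \sum_(0 <= l < k) s l.
  rewrite mulr_sumr !big_nat; apply: eq_bigr => l /andP[_ lk].
  by have := match_c l lk; rewrite /s; move: (bead _ _) (bead _ _) => x y; lia.
set S := \sum_(0 <= l < k) s l => eE.
set P := \sum_(0 <= l < k) _.
have dvdP : (2 %| P - S)%Z.
  rewrite /P /S -sumrB big_nat; apply: rpred_sum => l /andP[_ lk].
  exact: pair_parity (match_c l lk).
have -> : bead c k.*2 = (- S) * 2 by move: eE; move: (bead _ _) => e; lia.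
have -> : bz (- S * 2) = S * (2 * S + 1) by have := bzE (- S * 2); lia.
have -> : P + (t%:Z * (S * (2 * S + 1)) + k.*2%:Z * (- S * 2)) =
  (P - S) + (k%:Z * (S * (2 * S + 1)) + S * S + S - k.*2%:Z * S) * 2.
  have -> : t%:Z = 2 * k%:Z + 1 by rewrite /t; lia.
  by ring.
by rewrite rpredD // dvdz_mull.
Qed.

Lemma bead_dir_other (i j : 'I_t) c a : (a < t)%N -> a != i -> a != j ->
  bead (c + dir i j) a = bead c a.
Proof.
move=> a_lt ai aj; rewrite /bead ffunE dir_other ?addr0 //.
  by rewrite -val_eqE /= inordK.
by rewrite -val_eqE /= inordK.
Qed.

Lemma all_matched_dir (i j : 'I_t) c l : (l <= k)%N -> (l.*2 <= i)%N -> (l.*2 <= j)%N ->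
  all_matched l (c + dir i j) = all_matched l c.
Proof.
move=> lk li lj; rewrite /all_matched !big_nat; apply: eq_bigr => a /andP[_ al].
have lt_a : (a.*2.+1 < l.*2)%N by lia.
have lt_l : (l.*2 < t)%N by rewrite /t; lia.
have lt_a' := ltnW lt_a.
rewrite /matched (@bead_dir_other i j c a.*2) ?(@bead_dir_other i j c a.*2.+1) //.
- exact: ltn_trans lt_a lt_l.
- by rewrite neq_ltn (leq_trans lt_a li).
- by rewrite neq_ltn (leq_trans lt_a lj).
- exact: ltn_trans lt_a' lt_l.
- by rewrite neq_ltn (leq_trans lt_a' li).
- by rewrite neq_ltn (leq_trans lt_a' lj).
Qed.

Lemma all_matched01 l c : 0 <= all_matched l c <= 1.
Proof.
apply/andP; split; first by apply: prodr_ge0 => a _; rewrite ler0n.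
by apply: prodr_ile1 => a _; rewrite ler0n lern1 leq_b1.
Qed.

Lemma all_matchedS l c : all_matched l.+1 c = all_matched l c * matched l c.
Proof. by rewrite /all_matched big_nat_recr. Qed.

Lemma matched_dir (i j : 'I_t) c l : (l < k)%N -> i = l.*2 :> nat ->
  j = l.*2.+1 :> nat -> matched l (c + dir i j) = matched l c.
Proof.
move=> lk iE jE; have neq_ij : i != j by rewrite -val_eqE /= iE jE; lia.
rewrite /matched /bead -jE -iE !inord_val ![(c + _) _]ffunE dir_i // dir_j //.
congr (nat_of_bool _)%:R.
by move: (c i) (c j) => x y; lia.
Qed.

Lemma matched_dir_last (i j : 'I_t) c l : (l < k)%N -> i = l.*2 :> nat ->
  j = k.*2 :> nat -> matched l (c + dir i j) = 1 - matched l c.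
Proof.
move=> lk iE jE; have neq_ij : i != j by rewrite -val_eqE /= iE jE; lia.
rewrite /matched (@bead_dir_other i j c l.*2.+1) /t ?iE ?jE; [|lia..].
rewrite [bead (c + _) _]/bead /bead -iE inord_val ffunE dir_i //.
move: (c i) (c _) => x y.
have -> : (2 %| x + t%:Z - y)%Z = ~~ (2 %| x - y)%Z by rewrite /t; lia.
by case: (2 %| _)%Z; rewrite ?subrr ?subr0.
Qed.

(* Along dir (2l) (2l+1) the sign of core_size alternates when the pair l is  *)
(* unmatched.                                                                 *)
Lemma negligible_sign_matched l : (l <= k)%N ->
  negligible (fun _ c => sg R (core_size c) - sg R (core_size c) * all_matched l c).
Proof.
elim: l => [|l IHl] lk.
  have := @negligible0 R t; apply: eq_negligible => // n c _.
  by rewrite /all_matched big_geq // mulr1 subrr.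
have i_lt : (l.*2 < t)%N by rewrite /t; lia.
have j_lt : (l.*2.+1 < t)%N by rewrite /t; lia.
pose i : 'I_t := Ordinal i_lt; pose j : 'I_t := Ordinal j_lt.
have neq_ij : i != j by rewrite -val_eqE /=; lia.
(* The increment of the error from l to l+1: earlier pairs match but pair l does not. *)
pose h (_ : nat) c := sg R (core_size c) * (all_matched l c * (1 - matched l c)).
have nh : negligible h.
  apply: (negligible_alternating t_gt1 neq_ij) => n c; rewrite /h; last first.
    rewrite normrM norm_sg mul1r; have /andP[h0 h1] := all_matched01 l c.
    rewrite normrM ger0_norm // /matched; case: (2 %| _)%Z; rewrite ?subrr ?subr0 ?normr0 ?normr1 ?mulr0 ?mulr1 //.
  rewrite matched_dir // all_matched_dir //=; try lia.
  rewrite core_size_dir // sgD /matched; case: (boolP (2 %| _)%Z) => [_|odd_c].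
    by rewrite subrr !mulr0 oppr0.
  rewrite [sg R (t%:Z * _)]sg_odd; first by ring.
  move: odd_c; rewrite /bead /slope -[l.*2]/(val i) -[l.*2.+1]/(val j) !inord_val /=.
  move: (c i) (c j) => x y; rewrite expr2.
  have -> : t%:Z = 2 * k%:Z + 1 by rewrite /t; lia.
  have -> : (2 * k%:Z + 1) * ((2 * k%:Z + 1) * (x - y) + (2 * k%:Z + 1) * (2 * k%:Z + 1) +
     l.*2%:Z - l.*2.+1%:Z) =
    x - y + (2 * k%:Z * k%:Z + 2 * k%:Z) * (x - y + 2 * k%:Z + 1) * 2.
    by rewrite intS; ring.
  by move: (_ * (x - y + _ + _)) => q; lia.
have := negligibleD (IHl (ltnW lk)) nh; apply: eq_negligible => // n c _.
by rewrite /h all_matchedS; ring.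
Qed.

(* A step along dir (2l) (2k) toggles the pair l and no other pair.           *)
Lemma negligible_matched l : (l <= k)%N ->
  negligible (fun _ c => all_matched l c - (1 / 2 ^+ l)).
Proof.
elim: l => [|l IHl] lk.
  have := negligible_sign_matched (leq0n k); apply: eq_negligible => // n c _.
  by rewrite /all_matched big_geq // mulr1 subrr expr0 divr1 subrr.
have i_lt : (l.*2 < t)%N by rewrite /t; lia.
have j_lt : (k.*2 < t)%N by rewrite /t; lia.
pose i : 'I_t := Ordinal i_lt; pose j : 'I_t := Ordinal j_lt.
have neq_ij : i != j by rewrite -val_eqE /=; lia.
(* The new error is [h] plus half the previous error; toggling pair l negates [h]. *)
pose h (_ : nat) c := all_matched l c * (matched l c - 1 / 2).
have nh : negligible h.
  apply: (negligible_alternating t_gt1 neq_ij) => n c; rewrite /h; last first.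
    rewrite normrM; have /andP[h0 h1] := all_matched01 l c.
    rewrite ger0_norm // mulr_ile1 // ?normr_ge0 // /matched.
    by case: (2 %| _)%Z; rewrite /= ?mulr1n ?mulr0n ler_norml; lra.
  by rewrite (matched_dir_last _ lk) // all_matched_dir /=; [field|lia..].
have := negligibleD nh (negligibleZ (1 / 2) (IHl (ltnW lk))).
apply: eq_negligible => // n c _; rewrite /h all_matchedS exprS; field.
exact: expf_neq0.
Qed.

(** As t+1 is even, n + w and |c| have the same parity, so the sign is (-1)^|c|; on fully matched
    cores it is 1 by [core_size_parity]. *)
Lemma negligible_odd_modulus :
  negligible (fun n (c : {ffun 'I_t -> int}) => (-1) ^+ n * (-1) ^+ quo_size n c - 1 / 2 ^+ k : R).
Proof.
have := negligibleD (negligible_sign_matched (leqnn k)) (negligible_matched (leqnn k)).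
apply: eq_negligible => // n c ok; rewrite addrA; congr (_ - _).
have -> : sg R (core_size c) * all_matched k c = all_matched k c.
  have [all_m|] := boolP [forall l : 'I_k, 2 %| bead c l.*2 - bead c l.*2.+1]%Z.
    rewrite /sg core_size_parity ?mul1r //; first by case/and3P: ok => /eqP.
    by move=> l lk; exact: (forallP all_m (Ordinal lk)).
  move=> /forallPn[l odd_l]; suff -> : all_matched k c = 0 by rewrite mulr0.
  rewrite /all_matched big_mkord (bigD1 l) //= /matched (negbTE odd_l) mul0r //.
rewrite subrK -!sg_nat (quo_sizeE t_gt1 ok) sgD -mulrA -sgD.
have -> : t%:Z * (quo_size n c)%:Z + (quo_size n c)%:Z = 2 * (k.+1%:Z * (quo_size n c)%:Z).
  by rewrite /t; lia.
by rewrite [X in _ = _ * X]/sg dvdz_mulr // mulr1.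
Qed.

End OddModulus.

(** * From the bias to the densities *)

Section Densities.
Variables (R : realType) (t : nat).
Hypothesis t_gt1 : (1 < t)%N.

Definition bias n : R := csum n (fun c : {ffun 'I_t -> int} => (-1) ^+ quo_size n c) / (npart n)%:R.

Lemma delta_sum n : delta_even R t n + delta_odd R t n = 1.
Proof.
rewrite /delta_even /delta_odd -mulrDl -natrD.
have -> : (npart_even t n + npart_odd t n = npart n)%N.
  rewrite /npart_even /npart_odd /npart addnC.
  rewrite -(cardC [pred la : partition_of n | odd (size (t_hooks t la))]).
  by congr (_ + _)%N; apply: eq_card => la; rewrite !inE.
by rewrite divff // pnatr_eq0 -lt0n npart_gt0.
Qed.

Lemma delta_diff n : delta_even R t n - delta_odd R t n = bias n.
Proof.
rewrite /delta_even /delta_odd -mulrBl /bias; congr (_ / _).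
rewrite -(csum_hooks t_gt1 n (fun w => (-1) ^+ w)).
rewrite (bigID (fun la : partition_of n => odd (size (t_hooks t la)))) /= addrC; congr (_ + _).
  rewrite (eq_bigr (fun=> 1)) => [|la /negbTE odd_la]; last by rewrite -signr_odd odd_la.
  by rewrite sumr_const.
rewrite (eq_bigr (fun=> -1)) => [|la odd_la]; last by rewrite -signr_odd odd_la.
by rewrite sumr_const mulNrn.
Qed.

Lemma delta_evenE n : delta_even R t n = 1 / 2 + bias n / 2.
Proof. by have := delta_sum n; have := delta_diff n; lra. Qed.

Lemma delta_oddE n : delta_odd R t n = 1 / 2 - bias n / 2.
Proof. by have := delta_sum n; have := delta_diff n; lra. Qed.

End Densities.

Lemma cvg_within_eq (R : realType) (D : set nat) (a u : nat -> R) (l : R) :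
  (u n @[n --> \oo] --> l)%classic -> (forall n, D n -> a n = u n) ->
  (a n @[n --> within D \oo] --> l)%classic.
Proof.
move=> lim eq_au A /lim [N _ NP]; exists N => // n /= leNn Dn.
by rewrite /preimage /= eq_au //; exact: NP.
Qed.

Lemma bias_even_modulus (R : realType) t : (1 < t)%N -> ~~ odd t ->
  (bias R t n @[n --> \oo] --> (0 : R))%classic.
Proof. by move=> t_gt1 t_even; apply: negligible_even_modulus. Qed.

Lemma bias_odd_modulus (R : realType) t : (1 < t)%N -> odd t ->
  ((-1) ^+ n * bias R t n @[n --> \oo] --> (1 / 2 ^+ (t %/ 2) : R))%classic.
Proof.
move=> t_gt1 t_odd.
have k_gt0 : (0 < t %/ 2)%N by lia.
have tE : t = (t %/ 2).*2.+1 by lia.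
rewrite tE; move: k_gt0; move: (t %/ 2)%N => k k_gt0 {t t_gt1 t_odd tE}.
have -> : (k.*2.+1 %/ 2 = k)%N by lia.
have lim := cvgD (@negligible_odd_modulus R k k_gt0) (cvg_cst (1 / 2 ^+ k : R)).
rewrite add0r in lim; set a := (fun n => _ * bias R _ n).
have -> : a = (fun n => csum n (fun c : {ffun 'I_k.*2.+1 -> int} =>
    (-1) ^+ n * (-1) ^+ quo_size n c - 1 / 2 ^+ k) / (npart n)%:R) \+ (fun=> 1 / 2 ^+ k).
  rewrite /a; apply/funext => n /=; rewrite csumD csumZ.
  have -> : csum n (fun _ : {ffun 'I_k.*2.+1 -> int} => - (1 / 2 ^+ k)) =
      - (1 / 2 ^+ k) * (npart n)%:R :> R.
    rewrite -(@csum_npart R k.*2.+1); last by lia.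
    by rewrite -csumZ; apply: eq_csum => c _; rewrite mulr1.
  by rewrite /bias mulrDl mulfK ?subrK ?mulrA // pnatr_eq0 -lt0n npart_gt0.
exact: lim.
Qed.


Unset Implicit Arguments.
Set Strict Implicit.
Set Printing Implicit Defensive.
Local Open Scope classical_set_scope.
Local Open Scope ring_scope.

Theorem theorem1p1 (R : realType) (t : nat) (ht : (1 < t)%N) :
  (~~ odd t ->
     delta_even R t n @[n --> \oo] --> (1 / 2 : R) /\
     delta_odd R t n @[n --> \oo] --> (1 / 2 : R)) /\
  (odd t ->
     [/\ delta_even R t n @[n --> within [set m : nat | ~~ odd m] \oo]
           --> (1 / 2 + 1 / 2 ^+ ((t + 1) %/ 2)%N : R),
         delta_even R t n @[n --> within [set m : nat | odd m] \oo]
           --> (1 / 2 - 1 / 2 ^+ ((t + 1) %/ 2)%N : R),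
         delta_odd R t n @[n --> within [set m : nat | ~~ odd m] \oo]
           --> (1 / 2 - 1 / 2 ^+ ((t + 1) %/ 2)%N : R)
       & delta_odd R t n @[n --> within [set m : nat | odd m] \oo]
           --> (1 / 2 + 1 / 2 ^+ ((t + 1) %/ 2)%N : R)]).
Proof.
have lim_half (x l : R) (u : nat -> R) : u n @[n --> \oo] --> l ->
    1 / 2 + x * u n @[n --> \oo] --> 1 / 2 + x * l.
  by move=> lim; apply: cvgD; [exact: cvg_cst|apply: cvgM => //; exact: cvg_cst].
split=> [t_even|t_odd].
  have lim := @bias_even_modulus R t ht t_even; split.
    have := lim_half 2^-1 _ _ lim; rewrite mulr0 addr0; apply: cvg_trans.
    by apply: near_eq_cvg; apply: nearW => n; rewrite delta_evenE //; lra.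
  have := lim_half (- 2^-1) _ _ lim; rewrite mulr0 addr0; apply: cvg_trans.
  by apply: near_eq_cvg; apply: nearW => n; rewrite delta_oddE //; lra.
have lim := @bias_odd_modulus R t ht t_odd.
(* With k = (t-1)/2, half of the limiting bias 2^-k has exponent k+1 = (t+1)/2; the factor (-1)^n
   produces the two parity cases. *)
have -> : ((t + 1) %/ 2 = (t %/ 2).+1)%N by lia.
have half_pow : 1 / 2 ^+ (t %/ 2).+1 = 2^-1 * (1 / 2 ^+ (t %/ 2)) :> R.
  by rewrite exprS !div1r invfM.
rewrite !half_pow; have limN := lim_half (- 2^-1) _ _ lim.
rewrite mulNr in limN; have limP := lim_half 2^-1 _ _ lim.
split.
- apply: cvg_within_eq limP _ => n /= n_even.
  by rewrite delta_evenE // -signr_odd (negbTE n_even) mul1r; lra.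
- apply: cvg_within_eq limN _ => n /= n_odd.
  by rewrite delta_evenE // -signr_odd n_odd mulN1r; lra.
- apply: cvg_within_eq limN _ => n /= n_even.
  by rewrite delta_oddE // -signr_odd (negbTE n_even) mul1r; lra.
- apply: cvg_within_eq limP _ => n /= n_odd.
  by rewrite delta_oddE // -signr_odd n_odd mulN1r; lra.
Qed.
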